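(* Let $G$ be a finitely generated group with the Morse local-to-global property and let $P,Q$ be stable subgroups of $G$. For each finite generating set of $G$, there exists $C>0$ (depending only on the stability parameters of $P$ and $Q$) such that if $P\cap Q$ contains all elements of $P\cup Q$ whose length in $G$ is at most $C$, then the subgroup $\langle P,Q\rangle$ is stable in $G$ and isomorphic to $P*_{P\cap Q}Q$. Further, if $P$ is almost malnormal in $G$, then the same conclusion holds if we only require $P\cap Q$ to contain all elements of $P$ whose length in $G$ is at most $C$.
   Context: A $(\lambda,\kappa)$-quasi-geodesic ($\lambda\ge1,\kappa\ge0$) in a geodesic metric space $X$ is a map $\gamma:I\to X$, $I\subseteq\mathbb R$ a closed interval, with $\frac1\lambda|s-t|-\kappa\le d(\gamma(s),\gamma(t))\le\lambda|s-t|+\kappa$; quasi-geodesics are taken to be continuous. A Morse gauge is a function $M:\mathbb R_{\ge1}\times\mathbb R_{\ge0}\to\mathbb R_{\ge0}$. A quasi-geodesic $\gamma$ is $M$-Morse if every $(Q,q)$-quasi-geodesic with endpoints $\gamma(s),\gamma(t)$ is contained in the closed $M(Q,q)$-neighbourhood of $\gamma|_{[s,t]}$. A path is $L$-locally (P) if each of its restrictions to a subinterval of length at most $L$ has property (P). MLTG property of $X$: for every quasi-geodesic pair $(\lambda,\kappa)$ and Morse gauge $M$ there exist a scale $L$, a quasi-geodesic pair $(\lambda',\kappa')$ and a Morse gauge $M'$ such that every path that is $L$-locally an $M$-Morse $(\lambda,\kappa)$-quasi-geodesic is globally an $M'$-Morse $(\lambda',\kappa')$-quasi-geodesic. The property is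 a quasi-isometry invariant; a finitely generated group has it if its Cayley graph with respect to some (equivalently every) finite generating set does. Stable subgroup: let $S$ be a finite generating set of $G$. A subgroup $H\le G$ is stable if there exist a Morse gauge $M$ and $R\ge0$ (the stability parameters) such that in $\mathrm{Cay}(G,S)$ every two points of $H$ can be joined by an $M$-Morse geodesic contained in the $R$-neighbourhood of $H$. Stability does not depend on the choice of $S$. The length in $G$ of an element is its word length with respect to the chosen finite generating set. A subgroup $P\le G$ is almost malnormal if $P\cap gPg^{-1}$ is finite for every $g\in G\setminus P$. *)

(* Defs.v *)
From HB Require Import structures.
From mathcomp Require Import all_boot all_order all_algebra.
From mathcomp Require Import ring.
From mathcomp Require Import all_classical all_reals all_analysis.

Set Implicit Arguments.
Unset Strict Implicit.
Unset Printing Implicit Defensive.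

Import Order.TTheory GRing.Theory Num.Theory.
Import numFieldNormedType.Exports.

Local Open Scope classical_set_scope.
Local Open Scope ring_scope.

(* A map defined on an interval [I] is given by a total function [g : R -> X]
   together with [I : set R]; only the values of [g] on [I] matter, and the
   restriction of [g] to [J] is the same function considered on [J]. *)

Section QuasiGeodesics.
Context {R : realType} {X : metricType R}.
Implicit Types (I J : set R) (g : R -> X).

Definition is_path I g : Prop :=
  [/\ is_interval I, closed I & {within I, continuous g}].

Definition quasi_geodesic (l k : R) I g : Prop :=
  is_path I g /\
  forall s t, I s -> I t ->
    l^-1 * `|s - t| - k <= mdist (g s) (g t) <= l * `|s - t| + k.

Definition geodesic I g : Prop :=
  is_path I g /\ forall s t, I s -> I t -> mdist (g s) (g t) = `|s - t|.

(* This is the set of points at distance at most [r] from [A] when [A] is compact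
   or a set of vertices of a Cayley graph, the infimum being attained. *)
Definition closed_nbhd (A : set X) (r : R) : set X :=
  [set x | exists2 a, A a & mdist x a <= r].

End QuasiGeodesics.

(* Only the values on R_{>=1} x R_{>=0} are relevant. *)
Record morseGauge (R : realType) := MorseGauge {
  gauge :> R -> R -> R;
  gauge_ge0 : forall Q q, 1 <= Q -> 0 <= q -> 0 <= gauge Q q }.

Section Morse.
Context {R : realType} {X : metricType R}.
Implicit Types (I J : set R) (g : R -> X).

Definition morse (M : morseGauge R) I g : Prop :=
  forall (Q q : R) (s t : R) (a b : R) (eta : R -> X),
    1 <= Q -> 0 <= q -> I s -> I t -> s <= t -> a <= b ->
    quasi_geodesic Q q `[a, b]%classic eta -> eta a = g s -> eta b = g t ->
    eta @` `[a, b] `<=` closed_nbhd (g @` `[s, t]) (M Q q).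

Definition locally_on (L : R) (prop : set R -> (R -> X) -> Prop) I g : Prop :=
  forall a b : R, a <= b -> b - a <= L -> `[a, b]%classic `<=` I -> prop `[a, b]%classic g.

Definition morse_quasi_geodesic (M : morseGauge R) (l k : R) I g : Prop :=
  quasi_geodesic l k I g /\ morse M I g.

End Morse.

Definition MLTG (R : realType) (X : metricType R) : Prop :=
  forall (l k : R) (M : morseGauge R), 1 <= l -> 0 <= k ->
  exists (L l' k' : R) (M' : morseGauge R),
    [/\ 0 < L, 1 <= l', 0 <= k' &
      forall (I : set R) (g : R -> X), is_path I g ->
        locally_on L (morse_quasi_geodesic M l k) I g ->
        morse_quasi_geodesic M' l' k' I g].

(* Subgroups of [G] are terms of type [groupClosed G]; with classical logic
   every subset of [G] is a boolean predicate. *)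

Section Subgroups.
Context {G : groupType}.
Local Open Scope group_scope.
Implicit Types A : {pred G}.

Definition is_word A (w : seq G) : bool :=
  all (fun s => (s \in A) || (s^-1 \in A)) w.

Definition generated A : {pred G} :=
  fun x => `[< exists2 w : seq G, is_word A w & \prod_(s <- w) s = x >].

Lemma prodgV (w : seq G) :
  (\prod_(s <- w) s)^-1 = \prod_(s <- rev [seq s^-1 | s <- w]) s.
Proof.
elim: w => [|s w IH]; first by rewrite /= !big_nil invg1.
by rewrite big_cons invgM IH /= rev_cons -cats1 big_cat big_seq1.
Qed.

Lemma is_wordV A (w : seq G) :
  is_word A w -> is_word A (rev [seq s^-1 | s <- w]).
Proof.
move=> /allP ww; apply/allP => s; rewrite mem_rev => /mapP[t tw ->].
by rewrite invgK orbC; exact: ww.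
Qed.

Fact generated_closed A : group_closed (generated A).
Proof.
split; first by apply/asboolP; exists [::] => //; rewrite big_nil.
move=> x y /asboolP[w ww <-] /asboolP[v vv <-]; apply/asboolP.
exists (w ++ rev [seq s^-1 | s <- v]); last by rewrite big_cat prodgV.
by rewrite /is_word all_cat; apply/andP; split => //; exact: is_wordV.
Qed.

Definition groupClosed_of A (clA : group_closed A) : groupClosed G :=
  GroupClosed.Pack (GroupClosed.Class
    (isInvClosed.Build G A (group_closedV clA))
    (isMul1Closed.Build G A (fst clA))
    (isMulClosed.Build G A (group_closedM clA))).

Fact inter_closed (P Q : groupClosed G) : group_closed [predI P & Q].
Proof.
split=> [|x y]; first by rewrite inE !gpred1.
by rewrite !inE => /andP[xP xQ] /andP[yP yQ]; rewrite !gpredM ?gpredVr.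
Qed.

Definition interG (P Q : groupClosed G) : groupClosed G :=
  groupClosed_of (inter_closed P Q).

Definition joinG (P Q : groupClosed G) : groupClosed G :=
  groupClosed_of (generated_closed [predU P & Q]).

Definition almost_malnormal (P : groupClosed G) : Prop :=
  forall g : G, g \notin P ->
    finite_set [set x | x \in P /\ exists2 y, y \in P & x = g * y * g^-1].

End Subgroups.

Definition subgroup_type (G : groupType) (H : groupClosed G) : Type :=
  {x : G | x \in H}.

Section SubgroupType.
Variables (G : groupType) (H : groupClosed G).

Fact subgroup_closed : group_closed [in H].
Proof.
split; first exact: gpred1.
by move=> x y xH yH; apply: gpredM => //; apply: gpredVr.
Qed.

HB.instance Definition _ := SubChoice.on (subgroup_type H).
HB.instance Definition _ :=
  SubChoice_isSubGroup.Build G [in H] (subgroup_type H) subgroup_closed.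
End SubgroupType.

(* A finite generating set, listed by [gens]; inverses are not assumed to be in
   the list. *)
Record finGenSet (G : groupType) := FinGenSet {
  gens :> seq G;
  gens_generate : generated (mem gens) =i predT }.

Section WordLength.
Context {G : groupType} (S : finGenSet G).
Local Open Scope group_scope.

Fact word_length_ex (x : G) :
  exists n, `[< exists w : seq G,
    [/\ is_word (mem (gens S)) w, size w = n & \prod_(s <- w) s = x] >].
Proof.
have /asboolP[w ww wx] : x \in generated (mem (gens S)) by rewrite gens_generate.
by exists (size w); apply/asboolP; exists w.
Qed.

Definition word_length (x : G) : nat := ex_minn (word_length_ex x).

End WordLength.

Section CayleyGraph.
Context {R : realType} {G : groupType} (S : finGenSet G).

Definition adjacent_or_eq (g h : G) : bool :=
  [|| g == h, (g^-1 * h)%g \in gens S | (h^-1 * g)%g \in gens S].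

(* Barycentric coordinates of the point at distance [t] from [g] on the edge
   [g, h]; when [g = h] this is the vertex [g] for every [t]. *)
Definition bary (g h : G) (t : R) : G -> R :=
  fun u => (1 - t) * (u == g)%:R + t * (u == h)%:R.

Definition on_edge (f : G -> R) (g h : G) (t : R) : Prop :=
  [/\ adjacent_or_eq g h, 0 <= t <= 1 & f = bary g h t].

(* The geometric realization of the simplicial Cayley graph (no loops, no
   multiple edges), points being given by their barycentric coordinates. *)
Record cayley := Cayley {
  coord : G -> R;
  coord_on_edge : exists g h t, on_edge coord g h t }.

HB.instance Definition _ := gen_eqMixin cayley.
HB.instance Definition _ := gen_choiceMixin cayley.

Lemma coord_inj : injective coord.
Proof.
move=> [f fP] [g gP] /= fg; subst g; congr Cayley; exact: Prop_irrelevance.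
Qed.

Fact vertex_subproof (g : G) : exists a b t, on_edge (bary g g 0) a b t.
Proof.
by exists g, g, 0; split; rewrite ?lexx ?ler01 // /adjacent_or_eq eqxx.
Qed.

Definition vertex (g : G) : cayley := Cayley (vertex_subproof g).

(* [chain x y l]: there is a piecewise linear path of length [l] from [x] to
   [y]; the distance is the infimum of these lengths. *)
Inductive chain : cayley -> cayley -> R -> Prop :=
| chain_nil x : chain x x 0
| chain_cons x y z g h t s l :
    on_edge (coord x) g h t -> on_edge (coord y) g h s -> chain y z l ->
    chain x z (`|t - s| + l).

Definition cayley_dist (x y : cayley) : R := inf [set l | chain x y l].

Lemma chain_ge0 x y l : chain x y l -> 0 <= l.
Proof. by elim=> // *; rewrite addr_ge0. Qed.

Lemma chain_seg x y g h t s :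
  on_edge (coord x) g h t -> on_edge (coord y) g h s -> chain x y `|t - s|.
Proof.
by move=> xt ys; rewrite -[`|_|]addr0; exact: chain_cons xt ys (chain_nil y).
Qed.

Lemma chain_cat x y z l m : chain x y l -> chain y z m -> chain x z (l + m).
Proof.
move=> xy; elim: xy z m => [{}x z m|{}x {}y z g h t s {}l xt ys _ IH] //=.
  by rewrite add0r.
by move=> w m /IH zw; rewrite -addrA; exact: chain_cons xt ys zw.
Qed.

Lemma chain_sym x y l : chain x y l -> chain y x l.
Proof.
elim=> [{}x|{}x {}y z g h t s {}l xt ys _ IH]; first exact: chain_nil.
by rewrite addrC distrC; exact: chain_cat IH (chain_seg ys xt).
Qed.

Lemma chain_coord x y l : chain x y l -> forall u, `|coord x u - coord y u| <= l.
Proof.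
elim=> [{}x u|{}x {}y z g h t s {}l [gh t01 xt] [_ s01 ys] _ IH u].
  by rewrite subrr normr0.
apply: le_trans (ler_distD (coord y u) _ _) _; apply: lerD (IH u).
rewrite xt ys /bary.
have -> : (1 - t) * (u == g)%:R + t * (u == h)%:R -
          ((1 - s) * (u == g)%:R + s * (u == h)%:R) =
          (t - s) * ((u == h)%:R - (u == g)%:R) by ring.
rewrite normrM ler_piMr //.
by case: (u == h); case: (u == g); rewrite ?subrr ?subr0 ?sub0r ?normrN;
  rewrite ?normr0 ?normr1.
Qed.

Lemma bary0 g h : bary g h 0 = bary g g 0.
Proof. by apply/funext => u; rewrite /bary !mul0r. Qed.

Lemma bary1 g h : bary g h 1 = bary h h 0.
Proof. by apply/funext => u; rewrite /bary; ring. Qed.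

Lemma chain_edge g h : adjacent_or_eq g h -> chain (vertex g) (vertex h) 1.
Proof.
move=> gh; have -> : 1 = `|0 - 1| :> R by rewrite sub0r normrN normr1.
by apply: (@chain_seg _ _ g h); split; rewrite ?lexx ?ler01 //= ?bary0 ?bary1.
Qed.

Lemma chain_word (w : seq G) g : is_word (mem (gens S)) w ->
  chain (vertex g) (vertex (g * \prod_(s <- w) s)%g) (size w)%:R.
Proof.
elim: w g => [|s w IH] g /=; first by rewrite big_nil mulg1 => _; exact: chain_nil.
move=> /andP[sS ww]; rewrite big_cons mulgA -natr1 addrC.
apply: chain_cat (IH _ ww); apply: chain_edge; apply/or3P.
case/orP: sS => sS; first by apply: Or32; rewrite mulKg.
by apply: Or33; rewrite invgM -mulgA mulVg mulg1.
Qed.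

Lemma chain_vertex x : exists g l, chain x (vertex g) l.
Proof.
have [g [h [t xt]]] := coord_on_edge x; exists g, `|t - 0|.
apply: (chain_seg xt); case: xt => gh _ _.
by split; rewrite ?lexx ?ler01 //= bary0.
Qed.

Lemma chain_connected x y : exists l, chain x y l.
Proof.
have [g [l xg]] := chain_vertex x; have [h [m yh]] := chain_vertex y.
have /asboolP[w ww wE] : (g^-1 * h)%g \in generated (mem (gens S)).
  by rewrite gens_generate.
have := chain_word g ww; rewrite wE mulgA mulgV mul1g => gh.
by eexists; exact: chain_cat (chain_cat xg gh) (chain_sym yh).
Qed.

Lemma cayley_dist_le x y l : chain x y l -> cayley_dist x y <= l.
Proof. by move=> xy; apply: ge_inf => //; exists 0 => m; exact: chain_ge0. Qed.

Lemma cayley_dist_ge x y c :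
  (forall l, chain x y l -> c <= l) -> c <= cayley_dist x y.
Proof. by move=> H; apply: lb_le_inf => //; exact: chain_connected. Qed.

Fact cayley_distxx x : cayley_dist x x = 0.
Proof.
apply/eqP; rewrite eq_le cayley_dist_le /=; last exact: chain_nil.
by apply: cayley_dist_ge => l; exact: chain_ge0.
Qed.

Fact cayley_dist_eq0 x y : cayley_dist x y = 0 -> x = y.
Proof.
move=> xy; apply: coord_inj; apply/funext => u.
apply/eqP; rewrite -subr_eq0 -normr_le0 -xy.
by apply: cayley_dist_ge => l xyl; exact: chain_coord xyl u.
Qed.

Fact cayley_dist_sym x y : cayley_dist x y = cayley_dist y x.
Proof.
by congr inf; apply/seteqP; split => l /=; exact: chain_sym.
Qed.

Fact cayley_dist_triangle y x z :
  cayley_dist x z <= cayley_dist x y + cayley_dist y z.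
Proof.
rewrite -lerBlDl; apply: cayley_dist_ge => m yz.
rewrite lerBlDl -lerBlDr; apply: cayley_dist_ge => l xy.
by rewrite lerBlDr; exact: cayley_dist_le (chain_cat xy yz).
Qed.

HB.instance Definition _ := @isMetric.Build R cayley cayley_dist
  cayley_distxx cayley_dist_eq0 cayley_dist_sym cayley_dist_triangle.

End CayleyGraph.

Arguments cayley R {G} S.
Arguments vertex R {G} S g.

Definition MLTG_group (R : realType) (G : groupType) : Prop :=
  exists S : finGenSet G, MLTG (cayley R S).

Section Stable.
Context {R : realType} {G : groupType} (S : finGenSet G).

Definition stable_with (M : morseGauge R) (r : R) (H : groupClosed G) : Prop :=
  forall x y : G, x \in H -> y \in H ->
    exists (a b : R) (g : R -> cayley R S),
      [/\ a <= b, geodesic `[a, b]%classic g,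
          g a = vertex R S x /\ g b = vertex R S y,
          morse M `[a, b]%classic g &
          g @` `[a, b] `<=` closed_nbhd (vertex R S @` [set` H]) r].

End Stable.

Definition stable (R : realType) (G : groupType) (S : finGenSet G)
    (H : groupClosed G) : Prop :=
  exists (M : morseGauge R) (r : R), 0 <= r /\ stable_with S M r H.

(* The amalgam of [A] and [B] along [i : K -> A] and [j : K -> B]: words in the
   letters of [A + B] modulo the congruence generated by the multiplication
   tables of [A] and [B] and by [i k = j k]. *)
Section Amalgam.
Variables (K A B : groupType).
Variables (i : {multiplicative K -> A}) (j : {multiplicative K -> B}).

Inductive amalgam_eq : seq (A + B) -> seq (A + B) -> Prop :=
| amalgam_refl u : amalgam_eq u u
| amalgam_sym u v : amalgam_eq u v -> amalgam_eq v u
| amalgam_trans v u w : amalgam_eq u v -> amalgam_eq v w -> amalgam_eq u w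
| amalgam_cat u u' v v' :
    amalgam_eq u u' -> amalgam_eq v v' -> amalgam_eq (u ++ v) (u' ++ v')
| amalgam_1l : amalgam_eq [:: inl 1%g] [::]
| amalgam_1r : amalgam_eq [:: inr 1%g] [::]
| amalgam_Ml a a' : amalgam_eq [:: inl a; inl a'] [:: inl (a * a')%g]
| amalgam_Mr b b' : amalgam_eq [:: inr b; inr b'] [:: inr (b * b')%g]
| amalgam_glue k : amalgam_eq [:: inl (i k)] [:: inr (j k)].

Definition amalgam_rel : rel (seq (A + B)) := fun u v => `[< amalgam_eq u v >].

Fact amalgam_rel_equiv : equiv_class_of amalgam_rel.
Proof.
split.
- by move=> u; apply/asboolP; exact: amalgam_refl.
- by move=> u v; apply/asboolP/asboolP; exact: amalgam_sym.
- move=> v u w /asboolP uv /asboolP vw; apply/asboolP.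
  exact: amalgam_trans uv vw.
Qed.

Canonical amalgam_equiv := EquivRelPack amalgam_rel_equiv.

Definition amalgam : Type := {eq_quot amalgam_equiv}%qT.
HB.instance Definition _ := Choice.on amalgam.
HB.instance Definition _ := EqQuotient.on amalgam.

Definition amalgam_class (u : seq (A + B)) : amalgam := \pi_amalgam%qT u.

Lemma amalgam_classP u v :
  amalgam_class u = amalgam_class v <-> amalgam_eq u v.
Proof.
split => [/eqP|uv]; last by apply/eqmodP/asboolP.
by rewrite /amalgam_class eqmodE => /asboolP.
Qed.

Lemma amalgam_reprK (x : amalgam) : amalgam_class (repr x) = x.
Proof. exact: reprK. Qed.

Definition amalgam_letterV (c : A + B) : A + B :=
  match c with inl a => inl a^-1%g | inr b => inr b^-1%g end.

Definition amalgam_wordV (u : seq (A + B)) := rev (map amalgam_letterV u).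

Definition amalgam_mul (x y : amalgam) : amalgam :=
  amalgam_class (repr x ++ repr y).
Definition amalgam_one : amalgam := amalgam_class [::].
Definition amalgam_inv (x : amalgam) : amalgam :=
  amalgam_class (amalgam_wordV (repr x)).

Lemma amalgam_reprE u : amalgam_eq (repr (amalgam_class u)) u.
Proof. by apply/amalgam_classP; exact: amalgam_reprK. Qed.

Lemma amalgam_mulE u v :
  amalgam_mul (amalgam_class u) (amalgam_class v) = amalgam_class (u ++ v).
Proof.
by apply/amalgam_classP; apply: amalgam_cat; exact: amalgam_reprE.
Qed.

Fact amalgam_mulA : associative amalgam_mul.
Proof.
move=> x y z; rewrite -(amalgam_reprK x) -(amalgam_reprK y) -(amalgam_reprK z).
by rewrite !amalgam_mulE catA.
Qed.

Fact amalgam_mul1 : left_id amalgam_one amalgam_mul.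
Proof. by move=> x; rewrite -(amalgam_reprK x) amalgam_mulE. Qed.

Fact amalgam_1mul : right_id amalgam_one amalgam_mul.
Proof. by move=> x; rewrite -(amalgam_reprK x) amalgam_mulE cats0. Qed.

Lemma amalgam_letterVl c : amalgam_eq [:: amalgam_letterV c; c] [::].
Proof.
case: c => c /=; [apply: amalgam_trans amalgam_1l|apply: amalgam_trans amalgam_1r].
- by rewrite -(mulVg c); exact: amalgam_Ml.
- by rewrite -(mulVg c); exact: amalgam_Mr.
Qed.

Lemma amalgam_letterVK c : amalgam_letterV (amalgam_letterV c) = c.
Proof. by case: c => c /=; rewrite invgK. Qed.

Lemma amalgam_wordVl u : amalgam_eq (amalgam_wordV u ++ u) [::].
Proof.
elim: u => [|c u IH]; first exact: amalgam_refl.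
rewrite /amalgam_wordV /= rev_cons -cats1 -catA -[c :: u]cat1s.
apply: amalgam_trans IH; apply: amalgam_cat; first exact: amalgam_refl.
rewrite catA -[X in amalgam_eq _ X]cat0s.
by apply: amalgam_cat; [exact: amalgam_letterVl | exact: amalgam_refl].
Qed.

Lemma amalgam_wordVK u : amalgam_wordV (amalgam_wordV u) = u.
Proof.
rewrite /amalgam_wordV map_rev revK -map_comp map_id_in // => c _ /=.
exact: amalgam_letterVK.
Qed.

Fact amalgam_mulV : left_inverse amalgam_one amalgam_inv amalgam_mul.
Proof.
move=> x; rewrite -[X in amalgam_mul _ X]amalgam_reprK amalgam_mulE.
by apply/amalgam_classP; exact: amalgam_wordVl.
Qed.

Fact amalgam_Vmul : right_inverse amalgam_one amalgam_inv amalgam_mul.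
Proof.
move=> x; rewrite -[X in amalgam_mul X _]amalgam_reprK amalgam_mulE.
apply/amalgam_classP; have := amalgam_wordVl (amalgam_wordV (repr x)).
by rewrite amalgam_wordVK.
Qed.

HB.instance Definition _ := isGroup.Build amalgam
  amalgam_mulA amalgam_mul1 amalgam_1mul amalgam_mulV amalgam_Vmul.

End Amalgam.

Section Inclusions.
Variables (G : groupType) (P Q : groupClosed G).

Definition inter_inl (x : subgroup_type (interG P Q)) : subgroup_type P :=
  Sub (val x) (proj1 (andP (valP x))).

Definition inter_inr (x : subgroup_type (interG P Q)) : subgroup_type Q :=
  Sub (val x) (proj2 (andP (valP x))).

Fact inter_inlM : {morph inter_inl : x y / (x * y)%g}.
Proof. by move=> x y; exact: val_inj. Qed.

Fact inter_inrM : {morph inter_inr : x y / (x * y)%g}.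
Proof. by move=> x y; exact: val_inj. Qed.

HB.instance Definition _ := isMultiplicative.Build _ _ inter_inl inter_inlM.
HB.instance Definition _ := isMultiplicative.Build _ _ inter_inr inter_inrM.

(* P *_{P \cap Q} Q *)
Definition amalgam_inter : groupType := amalgam inter_inl inter_inr.

End Inclusions.

Definition isomorphic (G H : groupType) : Prop :=
  exists f : {multiplicative G -> H}, bijective f.

(* Main.v *)
Require Import Defs.
From HB Require Import structures.
From mathcomp Require Import all_boot all_order all_algebra.
From mathcomp Require Import ring lra zify.
From mathcomp Require Import all_classical all_reals all_analysis.

(** Everything is done with coarse paths, that is, maps from real intervals to
    [G] without continuity: a coarse quasi-geodesic in a Cayley graph is close to
    a continuous one, so Morse paths, stability and the Morse local-to-global
    property all have coarse counterparts, which make sense for the word metric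
    on [G] and do not depend on the generating set.

    An element of [<P, Q>] outside [P /\ Q] is a product of letters taken
    alternately from [P \ Q] and [Q \ P].  Among the products with the same
    number of letters choose one of least total length, and concatenate Morse
    paths in [P] or [Q] joining consecutive partial products.  If the two sides
    of a corner [a b] fellow-travelled for long, two of the matching pairs of
    points would differ by the same element of a ball, which yields [h] in
    [P /\ Q] such that [(a h) (h^-1 b)] is shorter than [a b].  So the corner is
    almost a nearest point, and the concatenation at the corner is a
    quasi-geodesic; it is Morse since a concatenation of Morse paths is Morse.
    When [P] is almost malnormal and the letter [b] in a product [a b c] with [a]
    and [c] in [P] is short, fellow-travelling of the outer sides produces many
    elements of the finite group [P /\ b P b^-1], whose order is bounded because
    a finite subgroup of [P] almost fixes the midpoint of its longest element.
    Once the letters are long enough, the local-to-global property makes the whole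
    path a Morse quasi-geodesic, hence [<P, Q>] is stable; comparing the length of
    the path with the distance of its ends, a nonempty alternating product is not
    trivial, which is the injectivity of the map from the amalgam. *)

Set Implicit Arguments.
Unset Strict Implicit.
Unset Printing Implicit Defensive.

Import Order.TTheory GRing.Theory Num.Theory.
Local Open Scope classical_set_scope.
Local Open Scope ring_scope.

(** * Coarse quasi-geodesics *)

Ltac order_lra := try match goal with |- is_true _ => lra end.

Section CoarseGeometry.
Context {R : realType} {T : Type}.
Implicit Types (d : T -> T -> R) (M : R -> R -> R) (f g : R -> T).

Definition is_pseudometric d := [/\ forall x, d x x = 0,
  forall x y, d x y = d y x & forall x y z, d x z <= d x y + d y z].

(** Continuity is not asked for. The lower bound of a quasi-geodesic is multiplied out by [l] and
    the parameters are taken in order, which suits linear arithmetic. *)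
Definition qgeo d (l k a b : R) f := forall s t, a <= s -> s <= t -> t <= b ->
  d (f s) (f t) <= l * (t - s) + k /\ t - s <= l * (d (f s) (f t) + k).

(** The competitors [eta] may be discontinuous. [M] is an arbitrary real function, which is why
    bounds derived from it are often truncated by [Num.max 0]. *)
Definition cmorse d M (a b : R) f :=
  forall (Q q s t a' b' : R) (eta : R -> T), 1 <= Q -> 0 <= q ->
    a <= s -> s <= t -> t <= b -> a' <= b' ->
    qgeo d Q q a' b' eta -> eta a' = f s -> eta b' = f t ->
    forall u, a' <= u -> u <= b' ->
    exists2 v, s <= v <= t & d (eta u) (f v) <= M Q q.

(** The additive error 1 leaves room for a path in a discrete group, which rests at a vertex for
    unit time. *)
Definition coarsely_geodesic d := forall x y : T, exists2 sigma : R -> T,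
  sigma 0 = x /\ sigma (d x y) = y & qgeo d 1 1 0 (d x y) sigma.

Lemma qgeo_sub d l k a b a' b' f :
  a <= a' -> b' <= b -> qgeo d l k a b f -> qgeo d l k a' b' f.
Proof. by move=> aa bb H s t ? ? ?; apply: H => //; lra. Qed.

Lemma qgeo_eq d l k a b f g : (forall t, a <= t -> t <= b -> f t = g t) ->
  qgeo d l k a b f -> qgeo d l k a b g.
Proof.
move=> fg H s t ? ? ?; rewrite -!fg; order_lra.
by apply: H.
Qed.

Lemma qgeo_shift d l k a b c f :
  qgeo d l k (a - c) (b - c) f -> qgeo d l k a b (fun t => f (t - c)).
Proof.
move=> H s t ? ? ?; have := H (s - c) (t - c).
have -> : t - c - (s - c) = t - s by lra.
by apply; lra.
Qed.

Lemma cmorse_sub d M a b a' b' f :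
  a <= a' -> b' <= b -> cmorse d M a b f -> cmorse d M a' b' f.
Proof.
move=> aa bb H Q q s t c e eta ? ? ? ? ? ce.
by apply: H => //; lra.
Qed.

Lemma cmorse_eq d M a b f g : (forall t, a <= t -> t <= b -> f t = g t) ->
  cmorse d M a b f -> cmorse d M a b g.
Proof.
move=> fg H Q q s t c e eta Q1 q0 ? ? ? ce He es et u cu ue.
have [v vst Hv] : exists2 v, s <= v <= t & d (eta u) (f v) <= M Q q.
  by apply: (H Q q s t c e eta) => //; rewrite fg //; lra.
by exists v => //; rewrite -fg //; lra.
Qed.

Lemma cmorse_shift d M a b c f :
  cmorse d M (a - c) (b - c) f -> cmorse d M a b (fun t => f (t - c)).
Proof.
move=> H Q q s t a' b' eta ? ? ? ? ? ? Hq es et u ? ?.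
have [] := H Q q (s - c) (t - c) a' b' eta _ _ _ _ _ _ Hq es et u => //; order_lra.
move=> v vst Hv; exists (v + c); first lra.
by rewrite addrK.
Qed.

Lemma cmorse_le d M M' a b f : (forall Q q, 1 <= Q -> 0 <= q -> M Q q <= M' Q q) ->
  cmorse d M a b f -> cmorse d M' a b f.
Proof.
move=> MM H Q q s t a' b' eta Q1 q0 h1 h2 h3 h4 h5 h6 h7 u h8 h9.
have [v vst Hv] := H Q q s t a' b' eta Q1 q0 h1 h2 h3 h4 h5 h6 h7 u h8 h9.
by exists v => //; apply: le_trans Hv _; exact: MM.
Qed.

(** * Reversal, perturbation and concatenation of coarse paths *)

Section Pseudometric.
Variables (d : T -> T -> R) (dP : is_pseudometric d).

Let dxx x : d x x = 0. Proof. by case: dP. Qed.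
Let dC x y : d x y = d y x. Proof. by case: dP. Qed.
Let dD x y z : d x z <= d x y + d y z. Proof. by case: dP => ? ?; apply. Qed.
Let d0 x y : 0 <= d x y.
Proof. by have := dD x y x; rewrite dxx (dC y x); lra. Qed.

Lemma qgeo_le l k l' k' a b f : 0 <= k -> 0 <= l -> l <= l' -> k <= k' ->
  qgeo d l k a b f -> qgeo d l' k' a b f.
Proof.
move=> k0 l0 ll kk H s t ? ? ?; have [|||H1 H2] := H s t => //.
split.
  have : l * (t - s) <= l' * (t - s) by apply: ler_wpM2r => //; lra.
  lra.
apply: le_trans H2 _; have := d0 (f s) (f t) => ?.
by apply: ler_pM => //; lra.
Qed.

Lemma qgeo_rev l k a b f :
  qgeo d l k a b f -> qgeo d l k (- b) (- a) (fun t => f (- t)).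
Proof.
move=> H s t ? ? ?; rewrite dC; have := H (- t) (- s).
have -> : - s - - t = t - s by lra.
by apply; lra.
Qed.

Lemma qgeo_near l k a b D f g : 0 <= l ->
  (forall t, a <= t -> t <= b -> d (f t) (g t) <= D) ->
  qgeo d l k a b f -> qgeo d l (k + 2 * D) a b g.
Proof.
move=> l0 fg H s t as_ st tb; have [|||H1 H2] := H s t => //.
have fs : d (f s) (g s) <= D by apply: fg; lra.
have ft : d (f t) (g t) <= D by apply: fg; lra.
have := dD (g s) (f s) (g t); have := dD (f s) (f t) (g t).
have := dD (f s) (g s) (f t); have := dD (g s) (g t) (f t).
rewrite (dC (g s) (f s)) (dC (g t) (f t)) => ? ? ? ?.
split; first lra.
apply: le_trans H2 _; apply: ler_wpM2l => //; lra.
Qed.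

Lemma cmorse_rev M a b f :
  cmorse d M a b f -> cmorse d M (- b) (- a) (fun t => f (- t)).
Proof.
move=> H Q q s t a' b' eta ? ? ? ? ? ? Hq es et u ? ?.
have [] := H Q q (- t) (- s) (- b') (- a') (fun u => eta (- u)) _ _ _ _ _ _ _ _ _ (- u) => //;
  order_lra.
- exact: qgeo_rev.
- by rewrite opprK.
- by rewrite opprK.
move=> v vst Hv; exists (- v); first lra.
by rewrite opprK; rewrite opprK in Hv.
Qed.

(* Coarse paths need not be continuous, so [eta] can be redefined at its ends. *)
Lemma cmorse_near M a b f D Q q s t a' b' eta :
  0 <= D -> cmorse d M a b f -> 1 <= Q -> 0 <= q -> a <= s -> s <= t -> t <= b ->
  a' <= b' -> qgeo d Q q a' b' eta -> d (eta a') (f s) <= D ->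
  d (eta b') (f t) <= D -> forall u, a' <= u -> u <= b' ->
  exists2 v, s <= v <= t & d (eta u) (f v) <= Num.max 0 (M Q (q + 2 * D)) + D.
Proof.
move=> D0 H Q1 q0 as_ st tb ab Hq es et u au ub.
have m0 : 0 <= Num.max 0 (M Q (q + 2 * D)) by rewrite le_max lexx.
have m1 : M Q (q + 2 * D) <= Num.max 0 (M Q (q + 2 * D)) by rewrite le_max lexx orbT.
move: ab; rewrite le_eqVlt => /orP[/eqP ab|ab].
  have -> : u = a' by lra.
  by exists s; [lra|apply: le_trans es _; lra].
pose eta' u := if u == a' then f s else if u == b' then f t else eta u.
have near' w : d (eta w) (eta' w) <= D.
  rewrite /eta'; case: eqP => [->//|_]; case: eqP => [->//|_].
  by rewrite dxx.
have ba : b' == a' = false by apply/eqP; lra.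
have [|||||||v vst Hv] := H Q (q + 2 * D) s t a' b' eta' Q1 _ as_ st tb _ _ _ _ u => //;
  order_lra.
- by apply: qgeo_near Hq => //; lra.
- by rewrite /eta' eqxx.
- by rewrite /eta' ba eqxx.
- exists v => //; have := dD (eta u) (eta' u) (f v); have := near' u; lra.
Qed.

(** Without continuity the infimum of the distances to [o] need not be attained, hence the slack
    1. *)
Lemma coarse_nearest a b f o : a <= b ->
  exists2 c, a <= c <= b & forall u, a <= u -> u <= b -> d o (f c) <= d o (f u) + 1.
Proof.
move=> ab; pose A := [set r | exists2 u, a <= u <= b & r = d o (f u)].
have hA : has_inf A.
  split; first by exists (d o (f a)); exists a => //; lra.
  by exists 0 => r [u _ ->].
have [r [c cab ->] rl] := inf_adherent (@ltr01 R) hA.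
exists c => // u au ub; have : inf A <= d o (f u).
  by apply: ge_inf; [case: hA|exists u => //; lra].
by move: rl; lra.
Qed.

(* [h] follows [f] up to [c], an almost nearest point to [o], and then a geodesic. *)
Lemma splice (G : coarsely_geodesic d) Q q a c f o : 1 <= Q -> 0 <= q -> a <= c ->
  qgeo d Q q a c f ->
  (forall u, a <= u -> u <= c -> d o (f c) <= d o (f u) + 1) ->
  exists b h, [/\ c <= b, qgeo d (3 * Q) (q + 5) a b h,
    forall u, u <= c -> h u = f u & h b = o].
Proof.
move=> Q1 q0 ac Hf near; have [sg [sg0 sg1] Hsg] := G (f c) o.
set ell := d (f c) o in sg1 Hsg.
pose h u := if u <= c then f u else sg (u - c).
have hf u : u <= c -> h u = f u by rewrite /h => ->.
have hs u : c <= u -> h u = sg (u - c).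
  rewrite /h le_eqVlt => /orP[/eqP <-|]; first by rewrite lexx subrr sg0.
  by rewrite leNgt => ->.
have l0 : 0 <= ell by exact: d0.
exists (c + ell), h; split => //; first lra; last first.
  by rewrite hs; [rewrite addrAC subrr add0r|lra].
move=> s t as_ st tb.
case: (leP t c) => [tc|ct].
  rewrite !hf; order_lra.
  by apply: (qgeo_le _ _ _ _ Hf); lra.
rewrite (hs t); last lra.
case: (leP c s) => [cs|sc].
  have -> : t - s = t - c - (s - c) by lra.
  by rewrite hs //; apply: (qgeo_le _ _ _ _ Hsg); lra.
rewrite (hf s); last lra.
have [|||U1 L1] := Hf s c; order_lra.
have [|||U2 L2] := Hsg 0 (t - c); order_lra.
have [|||U3 L3] := Hsg (t - c) ell; order_lra.
rewrite sg0 sg1 subr0 !mul1r in U2 L2 U3 L3.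
have N : ell <= d (f s) o + 1.
  by rewrite /ell dC (dC (f s)); apply: near; lra.
have T1 := dD (f s) (f c) (sg (t - c)).
have T2 := dD (f s) (sg (t - c)) o.
have T3 := dD (f s) (sg (t - c)) (f c).
rewrite (dC (sg _) (f c)) in T3.
set D := d (f s) (sg (t - c)) in T1 T2 T3 *.
have D0 : 0 <= D by exact: d0.
have QE : Q * (c - s) <= Q * (t - s) by apply: ler_wpM2l; lra.
split.
  have : (t - c) <= Q * (t - c) by rewrite ler_peMl //; lra.
  have : 0 <= Q * (c - s) by apply: mulr_ge0; lra.
  nra.
have X1 : t - c <= D + 2 by lra.
have X2 : D + 2 <= Q * (D + 2) by rewrite ler_peMl //; lra.
have X3 : Q * (d (f s) (f c) + q) <= Q * (2 * D + 3 + q).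
  by apply: ler_wpM2l; lra.
have X4 : 0 <= Q * q by apply: mulr_ge0; lra.
nra.
Qed.

(** A competitor that passes over [m] is cut at its almost nearest point to [f m]. By [splice], each
    half continued by a geodesic to [f m] is a quasi-geodesic with constants [3 * Q] and [q + 5]
    whose ends lie on a single Morse piece, and that piece controls it. *)
Lemma cmorse_cat (G : coarsely_geodesic d) M a m b f : a <= m -> m <= b ->
  cmorse d M a m f -> cmorse d M m b f ->
  cmorse d (fun Q q => Num.max (M Q q) (M (3 * Q) (q + 5))) a b f.
Proof.
move=> am mb H1 H2 Q q s t a' b' eta Q1 q0 as_ st tb ab Hq es et u au ub.
have m1 : M Q q <= Num.max (M Q q) (M (3 * Q) (q + 5)) by rewrite le_max lexx.
have m2 : M (3 * Q) (q + 5) <= Num.max (M Q q) (M (3 * Q) (q + 5)).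
  by rewrite le_max lexx orbT.
case: (leP t m) => tm.
  have [v vst Hv] := H1 Q q s t a' b' eta Q1 q0 as_ st tm ab Hq es et u au ub.
  by exists v => //; lra.
case: (leP m s) => ms.
  have [v vst Hv] := H2 Q q s t a' b' eta Q1 q0 ms st tb ab Hq es et u au ub.
  by exists v => //; lra.
have [c cab near] := coarse_nearest eta (f m) ab.
case: (leP u c) => uc.
  have [|||b'' [h [cb Hh hE hb]]] := @splice G Q q a' c eta (f m) Q1 q0 _ _ _.
  - lra.
  - by apply: qgeo_sub Hq; lra.
  - by move=> w ? ?; apply: near; lra.
  have [||||||||v vst Hv] := H1 (3 * Q) (q + 5) s m a' b'' h _ _ as_ _ _ _ Hh _ hb u => //;
      order_lra.
    by rewrite hE //; lra.
  rewrite hE // in Hv; exists v; lra.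
(* The second half is treated in reversed time, so that it too can be continued to [f m]. *)
have [|||b'' [h [cb Hh hE hb]]] :=
  @splice G Q q (- b') (- c) (fun t => eta (- t)) (f m) Q1 q0 _ _ _.
- lra.
- by apply: (@qgeo_sub _ _ _ (- b') (- a')); order_lra; exact: qgeo_rev.
- by move=> w ? ?; rewrite opprK; apply: near; lra.
have Hh' := qgeo_rev Hh.
have [||||||||||v vst Hv] := H2 (3 * Q) (q + 5) m t (- b'') b' (fun w => h (- w)) _ _ _ _
    tb _ _ _ _ u => //; order_lra.
- by rewrite opprK in Hh'.
- by rewrite opprK.
- by rewrite hE ?opprK //; lra.
- rewrite hE ?opprK in Hv; last lra.
  by exists v; lra.
Qed.

(* A coarse intermediate value argument: the points of [be] are close to [al], and
   their parameters on [al] cannot jump over [s] by much. *)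
Lemma morse_reverse M l k l1 k1 a b c e D al be :
  1 <= l -> 0 <= k -> 1 <= l1 -> 0 <= k1 -> 0 <= D -> a <= b -> c <= e ->
  qgeo d l k a b al -> cmorse d M a b al -> qgeo d l1 k1 c e be ->
  d (be c) (al a) <= D -> d (be e) (al b) <= D ->
  let K1 := Num.max 0 (M l1 (k1 + 2 * D)) + D in
  forall s, a <= s -> s <= b -> exists2 u, c <= u <= e &
    d (al s) (be u) <= l * (l * (2 * K1 + 2 * l1 + k1 + k)) + k + K1.
Proof.
move=> l_1 k_0 l11 k10 D0 ab ce Ha Ma Hb bc be_ K1 s as_ sb.
have near := cmorse_near D0 Ma l11 k10 (lexx a) ab (lexx b) ce Hb bc be_.
rewrite -/K1 in near.
have DK : D <= K1 by rewrite /K1 lerDr le_max lexx.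
clearbody K1; clear Ma.
(* [U] collects the parameters at which [be] is [K1]-close to [al] before [s]; just past its
   supremum the close point of [al] has to lie after [s]. *)
pose U := [set u | c <= u <= e /\ exists2 v, a <= v <= s & d (be u) (al v) <= K1].
have Uc : U c by split; [lra|exists a; [lra|lra]].
have hU : has_sup U by split; [exists c|exists e => u [? _]; lra].
have [u1 [u1ce [v1 v1s Hv1]] u1U] := sup_adherent (@ltr01 R) hU.
have subU u : U u -> u <= sup U by apply: ub_le_sup; case: hU.
have supe : sup U <= e by apply: ge_sup; [exists c|move=> u [? _]; lra].
have u1s : u1 <= sup U by apply: subU; split => //; exists v1.
move: supe u1U u1s subU; set m := sup U; move: m => m supe u1U u1s subU.
have [u2 [u12 u2e u2u1] [v2 v2s Hv2]] : exists2 u2, [/\ u1 <= u2, u2 <= e & u2 - u1 <= 2] &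
    exists2 v, s <= v <= b & d (be u2) (al v) <= K1.
  case: (leP (m + 1) e) => ue; last first.
    by exists e; [split; lra|exists b; [lra|lra]].
  exists (m + 1); first by split; lra.
  have [||v vab Hv] := near (m + 1); order_lra.
  case: (leP s v) => sv; first by exists v => //; lra.
  suff : m + 1 <= m by lra.
  by apply: subU; split; [lra|exists v => //; lra].
have [|||U1 _] := Hb u1 u2; order_lra.
have [|||_ L2] := Ha v1 v2; order_lra.
have [|||U3 _] := Ha v1 s; order_lra.
have T1 := dD (al v1) (be u1) (al v2); have T2 := dD (be u1) (be u2) (al v2).
have T3 := dD (al s) (al v1) (be u1).
rewrite (dC (al v1) (be u1)) in T1 T3; rewrite (dC (al s) (al v1)) in T3.
have l1u : l1 * (u2 - u1) <= l1 * 2 by apply: ler_wpM2l; lra.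
have X : l * (d (al v1) (al v2) + k) <= l * (2 * K1 + 2 * l1 + k1 + k).
  by apply: ler_wpM2l; lra.
have Y : l * (s - v1) <= l * (l * (2 * K1 + 2 * l1 + k1 + k)).
  by apply: ler_wpM2l; lra.
by exists u1; lra.
Qed.

(** [K1] bounds the distance from [be] to [al], and [K2] does so for pieces whose ends are only
    [K1]-close. The first two summands lead from [eta] to [al], the last one is the bound of
    [morse_reverse] from [al] to [be]. *)
Definition transfer_gauge M (l k l1 k1 D : R) (Q q : R) : R :=
  let K1 := Num.max 0 (M l1 (k1 + 2 * D)) + D in
  let K2 := Num.max 0 (M l1 (k1 + 2 * K1)) + K1 in
  Num.max 0 (M Q (q + 2 * K1)) + K1 +
  (l * (l * (2 * K2 + 2 * l1 + k1 + k)) + k + K2).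

(** A quasi-geodesic with ends on [be] has its ends close to [al], so it stays close to a piece of
    [al], and this piece is close to [be] by [morse_reverse]. *)
Lemma morse_transfer M l k l1 k1 a b c e D al be :
  1 <= l -> 0 <= k -> 1 <= l1 -> 0 <= k1 -> 0 <= D -> a <= b -> c <= e ->
  qgeo d l k a b al -> cmorse d M a b al -> qgeo d l1 k1 c e be ->
  d (be c) (al a) <= D -> d (be e) (al b) <= D ->
  cmorse d (transfer_gauge M l k l1 k1 D) c e be.
Proof.
move=> l_1 k_0 l11 k10 D0 ab ce Ha Ma Hb bc be_.
move=> Q q s t a' b' eta Q1 q0 cs st te ab' Hq es et u au ub.
rewrite /transfer_gauge; set K1 := Num.max 0 (M l1 (k1 + 2 * D)) + D; cbv zeta.
have K10 : 0 <= K1 by rewrite /K1 addr_ge0 // le_max lexx.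
have near := cmorse_near D0 Ma l11 k10 (lexx a) ab (lexx b) ce Hb bc be_.
have [||s' s'ab Hs'] := near s; order_lra.
have [||t' t'ab Ht'] := near t; order_lra.
rewrite -/K1 in Hs' Ht'.
(* The points of [al] close to the two ends may come in the opposite order; reversing [al] repairs
   this. *)
wlog : a b al ab Ha Ma s' t' s'ab t'ab Hs' Ht' {near bc be_} / s' <= t'.
  move=> W; case: (leP s' t') => [|ts]; first by apply: (W a b al).
  apply: (W (- b) (- a) (fun t => al (- t)) _ _ _ (- s') (- t')); rewrite ?opprK //; order_lra.
  - exact: qgeo_rev.
  - exact: cmorse_rev.
move=> st'.
rewrite -es in Hs'; rewrite -et in Ht'.
have [||v vst Hv] := cmorse_near K10 Ma Q1 q0 _ st' _ ab' Hq Hs' Ht' au ub; order_lra.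
rewrite es in Hs'; rewrite et in Ht'.
have [|||||w wst Hw] := @morse_reverse M l k l1 k1 s' t' s t K1 al be l_1 k_0 l11 k10 K10
    st' st _ _ _ Hs' Ht' v; order_lra.
- by apply: qgeo_sub Ha; lra.
- by apply: cmorse_sub Ma; lra.
- by apply: qgeo_sub Hb; lra.
- exists w => //; have := dD (eta u) (al v) (be w).
  by cbv zeta in Hw; move: (Num.max 0 (M Q _)) Hv (Num.max 0 (M l1 (k1 + 2 * K1))) Hw => *; lra.
Qed.

(** Since [f m] is almost as near to [f t] as any point of the first piece, [d (f s) (f m)] is at
    most twice [d (f s) (f t)] plus [C]. Both pieces are thus controlled by [d (f s) (f t)], at the
    price of the factor 3. *)
Lemma qgeo_cat l k C a m b f : 1 <= l -> 0 <= k -> 0 <= C -> a <= m -> m <= b ->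
  qgeo d l k a m f -> qgeo d 1 k m b f ->
  (forall s t, a <= s -> s <= m -> m <= t -> t <= b ->
     d (f m) (f t) <= d (f s) (f t) + C) ->
  qgeo d (3 * l) (2 * k + C) a b f.
Proof.
move=> l1 k0 C0 am mb H1 H2 near s t as_ st tb.
case: (leP t m) => tm.
  by apply: (qgeo_le _ _ _ _ H1) => //; lra.
case: (leP m s) => ms.
  by apply: (qgeo_le _ _ _ _ H2) => //; lra.
have [|||U1 L1] := H1 s m; order_lra.
have [|||U2 L2] := H2 m t; order_lra.
have N := near s t as_ (ltW ms) (ltW tm) tb.
have T1 := dD (f s) (f m) (f t).
have T2 := dD (f s) (f t) (f m); rewrite (dC (f t)) in T2.
set D := d (f s) (f t) in T1 T2 N *; have D0 : 0 <= D by exact: d0.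
rewrite !mul1r in U2 L2.
split.
  have : (t - m) <= l * (t - m) by rewrite ler_peMl //; lra.
  have : 0 <= l * (m - s) by apply: mulr_ge0; lra.
  nra.
have X1 : D + k + C <= l * (D + k + C) by rewrite ler_peMl //; lra.
have X3 : l * (d (f s) (f m) + k) <= l * (2 * D + k + C).
  by apply: ler_wpM2l; lra.
have X4 : 0 <= l * k by apply: mulr_ge0; lra.
have X5 : 0 <= l * C by apply: mulr_ge0; lra.
nra.
Qed.

End Pseudometric.
End CoarseGeometry.

(** * Corners in a group with two stable subgroups *)

Lemma pigeonhole (U : eqType) (s : seq U) (b : nat -> U) :
  (forall i, (i <= size s)%N -> b i \in s) ->
  exists i j, [/\ (i < j)%N, (j <= size s)%N & b i = b j].
Proof.
move=> bs; pose m := [seq b i | i <- iota 0 (size s).+1].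
have sm : size m = (size s).+1 by rewrite size_map size_iota.
have /(uniqPn (b 0)) [i [j [ij]]] : ~~ uniq m.
  apply/negP => um; have := uniq_leq_size um (s2 := s).
  rewrite sm ltnn => H; suff : false by []; apply: H => x /mapP[i].
  by rewrite mem_iota => /andP[_ ?] ->; exact: bs.
rewrite sm => js; rewrite !(nth_map 0%N) ?size_iota //; last exact: ltn_trans js.
rewrite !nth_iota //; last exact: ltn_trans js.
by rewrite !add0n => E; exists i, j.
Qed.

(** When [a], [a'], [v], [v'] lie in a subgroup [P], equal differences between points of [P] and of
    the coset [q P] produce an element of the intersection of [P] and [q P q^-1]. *)
Lemma conj_of_eq (G : groupType) (a a' q v v' : G) :
  (a^-1 * (q * v) = a'^-1 * (q * v') ->
   a * a'^-1 = q * (v * v'^-1) * q^-1)%g.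
Proof.
have X (x y c : G) : (x^-1 * y)%g = c -> x = (y * c^-1)%g.
  by move=> <-; rewrite invgM invgK mulVKg.
move=> /X -> ; move: (a'^-1 * (q * v'))%g (X a' (q * v')%g _ erefl) => c ->.
by rewrite !invgM !invgK !mulgA mulgVK.
Qed.

Section GroupGeometry.
Context {R : realType} {G : groupType}.
Variables (d : G -> G -> R) (dP : is_pseudometric d) (gd : coarsely_geodesic d)
  (dM : forall g x y, d (g * x)%g (g * y)%g = d x y)
  (ball : R -> seq G) (ballP : forall r x, d 1%g x <= r -> x \in ball r).
Implicit Types (P Q : groupClosed G) (M : R -> R -> R).

Let dxx x : d x x = 0. Proof. by case: dP. Qed.
Let dC x y : d x y = d y x. Proof. by case: dP. Qed.
Let dD x y z : d x z <= d x y + d y z. Proof. by case: dP => ? ?; apply. Qed.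
Let d0 x y : 0 <= d x y.
Proof. by have := dD x y x; rewrite dxx (dC y x); lra. Qed.

Lemma dist1 x y : d 1%g (x^-1 * y)%g = d x y.
Proof. by rewrite -[LHS](dM x) mulg1 mulVKg. Qed.

Lemma qgeo_mul l k a b (f : R -> G) g :
  qgeo d l k a b f -> qgeo d l k a b (fun t => g * f t)%g.
Proof. by move=> H s t ? ? ?; rewrite dM; exact: H. Qed.

Lemma cmorse_mul M a b (f : R -> G) g :
  cmorse d M a b f -> cmorse d M a b (fun t => g * f t)%g.
Proof.
move=> H Q q s t a' b' eta Q1 q0 as_ st tb ab Hq es et u au ub.
have [|||v vst Hv] := H Q q s t a' b' (fun u => g^-1 * eta u)%g Q1 q0 as_ st tb ab _ _ _ u
    au ub.
- exact: qgeo_mul.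
- by rewrite es mulKg.
- by rewrite et mulKg.
- by exists v => //; rewrite -(dM g^-1) mulKg.
Qed.

(* Since [P] is a subgroup, paths starting at [1] are enough. *)
Definition cstable l k M P := forall x, x \in P ->
  exists (A : R) (al : R -> G), [/\ 0 <= A, al 0 = 1%g /\ al A = x,
    (forall t, 0 <= t -> t <= A -> al t \in P),
    qgeo d l k 0 A al & cmorse d M 0 A al].

Lemma cstable_path l k M P x y : cstable l k M P -> x \in P -> y \in P ->
  exists (A : R) (al : R -> G), [/\ 0 <= A, al 0 = x /\ al A = y,
    (forall t, 0 <= t -> t <= A -> al t \in P),
    qgeo d l k 0 A al & cmorse d M 0 A al].
Proof.
move=> H xP yP; have [|A [al [A0 [a0 aA] aP aq am]]] := H (x^-1 * y)%g.
  by rewrite gpredM ?gpredVr.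
exists A, (fun t => x * al t)%g; split => //.
- by rewrite a0 aA mulg1 mulVKg.
- by move=> t t0 tA; rewrite gpredM ?aP.
- exact: qgeo_mul.
- exact: cmorse_mul.
Qed.

(** * Almost nearest points, finite subgroups and bounds on fellow-travelling at a corner *)

Definition nearest_const k M : R := 2 * M 3 (k + 5) + 4 * k.

(** Following [ga] up to its almost nearest point to [z], then a geodesic to [z], gives a
    quasi-geodesic by [splice]. So [ga c] is close to the Morse path [de] with the same ends, and a
    detour through [ga c] costs twice that distance and four errors [k]. *)
Lemma nearest_on_path k M a b a1 b1 (ga de : R -> G) z c : 0 <= k ->
  a <= c -> c <= b -> a1 <= b1 ->
  qgeo d 1 k a b ga -> qgeo d 1 k a1 b1 de -> cmorse d M a1 b1 de ->
  de a1 = ga a -> de b1 = z ->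
  (forall u, a <= u -> u <= c -> d z (ga c) <= d z (ga u) + 1) ->
  c - a + d (ga c) z <= d (ga a) z + nearest_const k M.
Proof.
move=> k0 ac cb ab1 Hg Hd Md da db near; rewrite /nearest_const.
have [|b' [h [cb' Hh hE hb]]] := splice dP gd (lexx 1) k0 ac _ near.
  by apply: qgeo_sub Hg; lra.
have [|||||v vab Hv] := Md (3 * 1) (k + 5) a1 b1 a b' h _ _ (lexx _) ab1 (lexx _) _ Hh _ _
    c ac cb'; order_lra.
- by rewrite hE.
- by rewrite hb.
rewrite hE // mulr1 in Hv.
have [|||U1 L1] := Hd a1 v; order_lra.
have [|||U2 L2] := Hd v b1; order_lra.
have [|||U3 L3] := Hd a1 b1; order_lra.
have [|||U4 L4] := Hg a c; order_lra.
rewrite da db !mul1r in U1 U2 L3 L4.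
have := dD (ga a) (de v) (ga c); have := dD (ga c) (de v) z.
rewrite (dC (de v) (ga c)); lra.
Qed.

(** On whichever side of [m] the almost nearest point to [z] lies, [nearest_on_path] from the
    opposite end shows that going from [ga m] through this point to [z] is short. *)
Lemma near_midpoint k M a b a1 b1 a2 b2 (ga de1 de2 : R -> G) z m r : 0 <= k ->
  a <= m -> m <= b -> a1 <= b1 -> a2 <= b2 -> qgeo d 1 k a b ga ->
  qgeo d 1 k a1 b1 de1 -> cmorse d M a1 b1 de1 ->
  qgeo d 1 k a2 b2 de2 -> cmorse d M a2 b2 de2 ->
  de1 a1 = ga a -> de1 b1 = z -> de2 a2 = ga b -> de2 b2 = z ->
  d (ga a) z <= r + (m - a) -> d (ga b) z <= r + (b - m) ->
  d (ga m) z <= r + nearest_const k M + k.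
Proof.
move=> k0 am mb ab1 ab2 Hg H1 M1 H2 M2 e1a e1b e2a e2b rz1 rz2.
have [|c cab near] := @coarse_nearest R G d dP a b ga z; first lra.
case: (leP m c) => mc.
  have [|||U1 L1] := Hg m c; order_lra.
  have : c - a + d (ga c) z <= d (ga a) z + nearest_const k M.
    by apply: (nearest_on_path k0 _ _ ab1 Hg H1 M1 e1a e1b) => [||u ? ?]; [| |apply: near]; lra.
  have := dD (ga m) (ga c) z; lra.
have [|||U1 L1] := Hg c m; order_lra.
have Hr := qgeo_rev dP Hg.
have : - c - - b + d (ga (- - c)) z <= d (ga (- - b)) z + nearest_const k M.
  apply: (nearest_on_path k0 _ _ ab2 Hr H2 M2 _ e2b) => [|||u ? ?]; order_lra.
    by rewrite opprK.
  by rewrite opprK; apply: near; lra.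
by rewrite !opprK; have := dD (ga m) (ga c) z; rewrite (dC (ga m) (ga c)); lra.
Qed.

(** Two uses of [near_midpoint], plus the [k] by which the distance between the ends of a path may
    exceed its parameter length. *)
Definition finite_const k M : R := 2 * (nearest_const k M + k) + k.

(* The midpoint of the longest element of a finite subgroup of [P] is almost
   fixed by the subgroup. *)
Lemma finite_subgroup_bounded k M P (F : set G) : 0 <= k -> cstable 1 k M P ->
  finite_set F -> F `<=` [set` P] -> F 1%g ->
  (forall x y, F x -> F y -> F (x^-1 * y)%g) ->
  exists p, forall x, F x -> d 1%g (p^-1 * (x * p))%g <= finite_const k M.
Proof.
move=> k0 sP finF FP F1 FM.
have FV x : F x -> F x^-1%g by move=> Fx; rewrite -(mulg1 x^-1%g); exact: FM.
have [x0 Fx0 xmax] : exists2 x0, F x0 & forall x, F x -> d 1%g x <= d 1%g x0.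
  have /finite_seqP[s sF] := finF.
  suff [x0 Fx0 H] : exists2 x0, F x0 & forall x, x \in s -> d 1%g x <= d 1%g x0.
    by exists x0 => // x; rewrite [X in X x]sF; exact: H.
  have : forall x, x \in s -> F x by move=> x xs; rewrite sF.
  elim: s {sF} => [|y s IH] sF; first by exists 1%g.
  have [x xs|x0 Fx0 H] := IH; first by apply: sF; rewrite inE xs orbT.
  case: (leP (d 1%g y) (d 1%g x0)) => yx.
    by exists x0 => // x; rewrite inE => /orP[/eqP->//|]; exact: H.
  exists y; first by apply: sF; rewrite inE eqxx.
  move=> x; rewrite inE => /orP[/eqP->//|/H]; lra.
have [|A [ga [A0 [g0 gA] gP gq _]]] := sP x0; first exact: FP.
pose p := ga (A / 2).
have pP : p \in P by apply: gP; lra.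
have [|||U L] := gq 0 A; order_lra; rewrite g0 gA in U L.
set D := d 1%g x0 in U L xmax.
have mid z r : z \in P -> d 1%g z <= r + A / 2 -> d x0 z <= r + A / 2 ->
    d p z <= r + nearest_const k M + k.
  move=> zP z1 z2.
  have [A1 [de1 [A10 [d10 d1A] _ d1q d1m]]] := cstable_path sP (@gpred1 _ P) zP.
  have [A2 [de2 [A20 [d20 d2A] _ d2q d2m]]] := cstable_path sP (FP _ Fx0) zP.
  apply: (@near_midpoint k M 0 A 0 A1 0 A2 ga de1 de2) => //; order_lra; rewrite ?g0 ?gA
      //; order_lra.
(* Both [x] and [x0^-1 * x] are in [F], so they are no longer than [x0]. *)
have pF x : F x -> d p x <= D - A / 2 + nearest_const k M + k.
  move=> Fx; apply: mid; first exact: FP.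
    by have := xmax _ Fx; lra.
  by rewrite -dist1; have := xmax _ (FM _ _ Fx0 Fx); lra.
exists p => x Fx; rewrite dist1 /finite_const.
(* The point [x * p] has the same distances to [1] and [x0] as [p] has to [x^-1] and [x^-1 * x0],
   which are in [F] and hence bounded by [pF]. *)
suff : d p (x * p)%g <= D - A + nearest_const k M + k + nearest_const k M + k by lra.
apply: mid.
- by rewrite gpredM //; exact: FP.
- rewrite -(dM x^-1%g) mulKg mulg1 dC.
  have := pF _ (FV _ Fx); lra.
- rewrite -(dM x^-1%g) mulKg dC.
  have := pF _ (FM _ _ Fx Fx0); lra.
Qed.

Definition corner_const k K0 : R := (size (ball K0))%:R * (2 * K0 + 7 * k + 1).

(* Two long fellow-travelling segments of the sides of a corner produce, by the
   pigeonhole principle, an element of the intersection shortening both sides. *)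
Lemma minimal_corner k K0 P Q A B c (ga : R -> G) : 0 <= k -> 0 <= K0 ->
  0 <= A -> 0 <= B ->
  ga 0 = 1%g -> (forall t, - A <= t -> t <= 0 -> ga t \in P) ->
  (forall t, 0 <= t -> t <= B -> ga t \in Q) ->
  qgeo d 1 k (- A) 0 ga -> qgeo d 1 k 0 B ga ->
  (forall h, h \in P -> h \in Q ->
     d (ga (- A)) 1%g + d 1%g (ga B) <= d (ga (- A)) h + d h (ga B)) ->
  c <= A ->
  (forall u, 0 <= u -> u <= c -> exists2 v, 0 <= v <= B & d (ga (- u)) (ga v) <= K0) ->
  c <= corner_const k K0.
Proof.
move=> k0 K00 A0 B0 g0 gP gQ q1 q2 hmin cA fel; rewrite /corner_const.
(* The first side is sampled at [N + 1] points with spacing [De], large enough for the shortening to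
   outweigh all additive errors. *)
case: leP => // cT; set De := 2 * K0 + 7 * k + 1 in cT; set N := size _ in cT.
have De0 : 0 < De by rewrite /De; lra.
have iD i : (i <= N)%N -> 0 <= i%:R * De <= c.
  move=> iN; rewrite mulr_ge0 ?ler0n ?(ltW De0) //=.
  by apply: le_trans (ltW cT); rewrite ler_pM2r // ler_nat.
have [v vP] : exists v : nat -> R, forall i, (i <= N)%N ->
    0 <= v i <= B /\ d (ga (- (i%:R * De))) (ga (v i)) <= K0.
  suff /choice [v vP] : forall i, exists w, (i <= N)%N ->
      0 <= w <= B /\ d (ga (- (i%:R * De))) (ga w) <= K0 by exists v.
  move=> i; case: (leqP i N) => [iN|]; last by exists 0.
  have /andP[i0 ic] := iD _ iN.
  by have [w w1 w2] := fel _ i0 ic; exists w.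
have [|i [j [ij jN]]] := @pigeonhole _ (ball K0)
    (fun i => (ga (- (i%:R * De)))^-1 * ga (v i))%g.
  by move=> i iN; apply: ballP; rewrite dist1; case: (vP _ iN).
rewrite -/N in jN; have iN : (i <= N)%N := leq_trans (ltnW ij) jN.
have [/andP[vi0 viB] vi] := vP _ iN; have [/andP[vj0 vjB] vj] := vP _ jN.
have /andP[si0 sic] := iD _ iN; have /andP[sj0 sjc] := iD _ jN.
have sij : De <= j%:R * De - i%:R * De.
  by rewrite -mulrBl -natrB ?(ltnW ij) // ler_peMl ?(ltW De0) // ler1n subn_gt0.
move: (i%:R * De) (j%:R * De) (v i) (v j) si0 sic sj0 sjc sij vi0 viB vi vj0 vjB vj
  => {iD vP fel} si sj ti tj si0 sic sj0 sjc sij ti0 tiB vi tj0 tjB vj E.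
(* By the coincidence from the pigeonhole principle, [h] is also the quotient of the matching points
   on the other side, so it lies in both subgroups. Meeting at [h] instead of [1] skips the part
   between the two samples on each side. *)
pose h := (ga (- sj) * (ga (- si))^-1)%g.
have hE : h = (ga tj * (ga ti)^-1)%g.
  by apply: (mulIg (ga ti)); rewrite mulgVK -mulgA E mulVKg.
have hP : h \in P by rewrite gpredM ?gpredVr // gP //; lra.
have hQ : h \in Q by rewrite hE gpredM ?gpredVr // gQ //; lra.
have := hmin h hP hQ.
have hs : d (ga (- sj)) h = d (ga (- si)) 1%g.
  by rewrite -dist1 mulKg -(dM (ga (- si))) mulgV mulg1.
have ht : d h (ga tj) = d 1%g (ga ti).
  by rewrite hE dC -dist1 mulKg dC -dist1 invgK mulg1 -(dM (ga ti)^-1%g) mulg1 mulVg dC.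
have T1 := dD (ga (- A)) (ga (- sj)) h; have T2 := dD h (ga tj) (ga B).
rewrite hs in T1; rewrite ht in T2.
have [|||U1 L1] := q1 (- A) (- sj); order_lra.
have [|||U2 L2] := q1 (- si) 0; order_lra.
have [|||U2' L2'] := q1 (- sj) 0; order_lra.
have [|||U3 L3] := q1 (- A) 0; order_lra.
have [|||U4 L4] := q2 tj B; order_lra.
have [|||U5 L5] := q2 0 ti; order_lra.
have [|||U5' L5'] := q2 0 tj; order_lra.
have [|||U6 L6] := q2 0 B; order_lra.
rewrite g0 in U2 L2 U2' L2' U3 L3 U5 L5 U5' L5' U6 L6.
have T3 := dD 1%g (ga (- si)) (ga ti); have T4 := dD (ga (- sj)) (ga tj) 1%g.
rewrite (dC 1%g (ga (- si))) in T3; rewrite (dC (ga tj) 1%g) in T4.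
clear -k0 K00 sij T1 T2 T3 T4 U1 L1 U2 L2 U2' L2' U3 L3 U4 L4 U5 L5 U5' L5' U6 L6 vi vj.
rewrite /De in sij => Hm; lra.
Qed.

(** The number of pairs of a short difference and a conjugated element of the finite intersection,
    times a spacing [k + 1] that keeps sample points distinct. *)
Definition malnormal_const k K0 M : R :=
  (size (ball K0) * size (ball (finite_const k M)))%:R * (k + 1).

(** Sample points of [al] with the same difference to [q P] have quotients in the intersection of
    [P] and [q P q^-1], finite by almost malnormality. A conjugate of it lies in a ball of radius
    [finite_const k M], so too many samples would force two of them to be equal. *)
Lemma malnormal_corner k K0 M P q A c (al : R -> G) : 0 <= k -> 0 <= K0 ->
  cstable 1 k M P -> almost_malnormal P -> q \notin P ->
  (forall t, 0 <= t -> t <= A -> al t \in P) -> qgeo d 1 k 0 A al -> c <= A ->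
  (forall u, 0 <= u -> u <= c -> exists2 p, p \in P & d (al u) (q * p)%g <= K0) ->
  c <= malnormal_const k K0 M.
Proof.
move=> k0 K00 sP mal qP aP aq cA fel; rewrite /malnormal_const.
case: leP => // cT; set De := k + 1 in cT.
have De0 : 0 < De by rewrite /De; lra.
pose F : set G := [set x | x \in P /\ exists2 y, y \in P & x = (q * y * q^-1)%g].
have [x Fx||x y Fx Fy|z zF] := @finite_subgroup_bounded k M P F k0 sP (mal _ qP).
- by case: Fx.
- by split; [exact: gpred1|exists 1%g; [exact: gpred1|rewrite mulg1 mulgV]].
- case: Fx => xP [x' x'P xE]; case: Fy => yP [y' y'P yE]; split.
    by rewrite gpredM ?gpredVr.
  exists (x'^-1 * y')%g; first by rewrite gpredM ?gpredVr.
  by rewrite xE yE !invgM invgK !mulgA mulgVK.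
set N1 := size _ in cT; set N2 := size _ in cT; set N := (N1 * N2)%N in cT.
have iD i : (i <= N)%N -> 0 <= i%:R * De <= c.
  move=> iN; rewrite mulr_ge0 ?ler0n ?(ltW De0) //=.
  by apply: le_trans (ltW cT); rewrite ler_pM2r // ler_nat.
pose a i := al (i%:R * De).
have aiP i : (i <= N)%N -> a i \in P.
  by move=> /iD/andP[? ?]; apply: aP => //; lra.
have [v vP] : exists v : nat -> G, forall i, (i <= N)%N ->
    v i \in P /\ d (a i) (q * v i)%g <= K0.
  suff /choice [v vP] : forall i, exists w, (i <= N)%N ->
      w \in P /\ d (a i) (q * w)%g <= K0 by exists v.
  move=> i; case: (leqP i N) => [iN|]; last by exists 1%g.
  have /andP[i0 ic] := iD _ iN.
  by have [w w1 w2] := fel _ i0 ic; exists w.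
pose b i := ((a i)^-1 * (q * v i))%g.
(* [r g] chooses one index with difference [g], so that all samples with this difference are
   compared with the same one; it is applied to values [b i] with [i <= N], where the default 0 does
   not intervene. *)
pose r g := xget 0%N [set j | (j <= N)%N /\ b j = g].
have rP i : (i <= N)%N -> (r (b i) <= N)%N /\ b (r (b i)) = b i.
  by move=> iN; rewrite /r; apply: (@xgetPex _ 0%N [set j | (j <= N)%N /\ b j = b i]); exists i.
pose e i := (z^-1 * (a i * (a (r (b i)))^-1 * z))%g.
have [i iN|i [j [ij jN [E1 E2]]]] := @pigeonhole _ (allpairs pair (ball K0) (ball
    (finite_const k M)))
    (fun i => (b i, e i)).
  rewrite size_allpairs -/N1 -/N2 -/N in iN.
  apply/allpairsP; exists (b i, e i); split => //=; apply: ballP.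
    by rewrite /b dist1; case: (vP _ iN).
  apply: zF; have [rN rE] := rP _ iN; split; first by rewrite gpredM ?gpredVr ?aiP.
  have [vi _] := vP _ iN; have [vr _] := vP _ rN.
  exists (v i * (v (r (b i)))^-1)%g; first by rewrite gpredM ?gpredVr.
  exact: conj_of_eq (esym rE).
rewrite size_allpairs -/N1 -/N2 -/N in jN.
have iN : (i <= N)%N := leq_trans (ltnW ij) jN.
(* The same reference sample and the same quotient give the same point, which the spacing [k + 1]
   forbids. *)
have aij : a i = a j.
  by move: E2; rewrite /e E1 => /mulgI/mulIg/mulIg.
have /andP[si0 sic] := iD _ iN; have /andP[sj0 sjc] := iD _ jN.
have sij : De <= j%:R * De - i%:R * De.
  by rewrite -mulrBl -natrB ?(ltnW ij) // ler_peMl ?(ltW De0) // ler1n subn_gt0.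
have [|||_ L] := aq (i%:R * De) (j%:R * De); order_lra.
rewrite -/(a i) -/(a j) aij dxx in L.
by rewrite /De in sij L *; lra.
Qed.

(** The first side, followed back from the corner to an almost nearest point to [ga t] and continued
    by a geodesic, is Morse-close to the second side. The assumed bound on fellow-travelling puts
    that point within [C] of the corner, so the corner is itself nearest up to [l * C + k + 1] and
    [qgeo_cat] applies. *)
Lemma corner_qgeo l k M A B C (ga : R -> G) : 1 <= l -> 0 <= k -> 0 <= A -> 0 <= B ->
  0 <= C ->
  qgeo d l k (- A) 0 ga -> qgeo d 1 k 0 B ga -> cmorse d M 0 B ga ->
  (forall c, 0 <= c -> c <= A -> (forall u, 0 <= u -> u <= c ->
     exists2 v, 0 <= v <= B & d (ga (- u)) (ga v) <= Num.max 0 (M (3 * l) (k + 5))) ->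
     c <= C) ->
  qgeo d (3 * l) (2 * k + (l * C + k + 1)) (- A) B ga.
Proof.
move=> l1 k0 A0 B0 C0 q1 q2 m2 bnd.
have lC : 0 <= l * C by apply: mulr_ge0 => //; lra.
apply: (qgeo_cat dP l1 k0 _ _ B0 q1 q2); try lra.
move=> s t As s0 t0 tB.
pose f u := ga (- u).
have qf : qgeo d l k 0 A f by have := qgeo_rev dP q1; rewrite opprK oppr0.
have [c cA near] := coarse_nearest dP f (ga t) A0.
have [|||b' [h [cb' Hh hE hb]]] := @splice R G d dP gd l k 0 c f (ga t) l1 k0.
- lra.
- by apply: qgeo_sub qf; lra.
- by move=> u ? ?; apply: near; lra.
have cC : c <= C.
  apply: bnd; try lra.
  move=> u u0 uc.
  have [|||||v vt Hv] := m2 (3 * l) (k + 5) 0 t 0 b' h _ _ (lexx _) t0 tB _ Hh _ hb u u0 _;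
      order_lra.
    by rewrite hE /f ?oppr0 //; lra.
  rewrite hE // in Hv; exists v; first lra.
  by apply: le_trans Hv _; rewrite le_max lexx orbT.
have [|||U L] := qf 0 c; order_lra; rewrite /f oppr0 in U.
have lc : l * (c - 0) <= l * C by apply: ler_wpM2l; lra.
have := near (- s); rewrite /f opprK => N; have := dD (ga 0) (ga (- c)) (ga t).
rewrite (dC (ga t) (ga (- c))) (dC (ga t) (ga s)) in N.
move=> T1; have {}N : d (ga (- c)) (ga t) <= d (ga s) (ga t) + 1 by apply: N; lra.
lra.
Qed.

Lemma corner_const_ge0 k K0 : 0 <= k -> 0 <= K0 -> 0 <= corner_const k K0.
Proof. by move=> ? ?; rewrite mulr_ge0 //; lra. Qed.

Lemma malnormal_const_ge0 k K0 M : 0 <= k -> 0 <= malnormal_const k K0 M.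
Proof. by move=> ?; rewrite mulr_ge0 //; lra. Qed.

Let max_ge0 (x : R) : 0 <= Num.max 0 x. Proof. by rewrite le_max lexx. Qed.

Definition cat_gauge M (Q q : R) : R := Num.max (M Q q) (M (3 * Q) (q + 5)).

Lemma cat_gauge_le M (l k : R) : M l k <= cat_gauge M l k.
Proof. by rewrite le_max lexx. Qed.

(** The additive constant of [corner_qgeo] for [l = 1] and the fellow-travelling bound of
    [minimal_corner]. *)
Definition pair_const k M : R :=
  2 * k + (corner_const k (Num.max 0 (M 3 (k + 5))) + k + 1).

Lemma pair_const_ge k M : 0 <= k -> k <= pair_const k M.
Proof.
move=> k0; have := corner_const_ge0 k0 (max_ge0 (M 3 (k + 5))).
by rewrite /pair_const; lra.
Qed.

Lemma pair_geo k M P Q A B (ga : R -> G) : 0 <= k -> 0 <= A -> 0 <= B ->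
  ga 0 = 1%g -> (forall t, - A <= t -> t <= 0 -> ga t \in P) ->
  (forall t, 0 <= t -> t <= B -> ga t \in Q) ->
  qgeo d 1 k (- A) 0 ga -> qgeo d 1 k 0 B ga ->
  cmorse d M (- A) 0 ga -> cmorse d M 0 B ga ->
  (forall h, h \in P -> h \in Q ->
     d (ga (- A)) 1%g + d 1%g (ga B) <= d (ga (- A)) h + d h (ga B)) ->
  qgeo d 3 (pair_const k M) (- A) B ga /\ cmorse d (cat_gauge M) (- A) B ga.
Proof.
move=> k0 A0 B0 g0 gP gQ q1 q2 m1 m2 hmin; split; last first.
  by apply: (cmorse_cat dP gd) m1 m2; lra.
have := @corner_qgeo 1 k M A B (corner_const k (Num.max 0 (M 3 (k + 5)))) ga
  (lexx _) k0 A0 B0 (corner_const_ge0 k0 (max_ge0 _)) q1 q2 m2.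
rewrite mulr1 mul1r; apply=> c c0 cA fel.
exact: (minimal_corner k0 (max_ge0 _) A0 B0 g0 gP gQ q1 q2 hmin cA fel).
Qed.

(** The additive constant of [corner_qgeo] for [l = 3], the first side being a two-letter path;
    fellow-travelling is bounded by the sum of the bounds on its two letters. *)
Definition triple_const k M : R :=
  let k1 := pair_const k M in let K0 := Num.max 0 (cat_gauge M 9 (k1 + 5)) in
  2 * k1 + (3 * (corner_const k K0 + malnormal_const k K0 M) + k1 + 1).

Lemma triple_const_ge k M : 0 <= k -> pair_const k M <= triple_const k M.
Proof.
move=> k0; have k1 := pair_const_ge M k0; rewrite /triple_const.
have := corner_const_ge0 k0 (max_ge0 (cat_gauge M 9 (pair_const k M + 5))).
have := malnormal_const_ge0 (Num.max 0 (cat_gauge M 9 (pair_const k M + 5))) M k0.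
by cbv zeta; lra.
Qed.

(** At the second corner, fellow-travelling along the middle letter is bounded by [minimal_corner]
    with [P] and [Q] exchanged. If it goes on past the middle letter, the two outer letters
    fellow-travel, and [malnormal_corner] bounds the rest. *)
Lemma triple_geo k M P Q A E B (ga : R -> G) : 0 <= k -> 0 <= A -> 0 <= E -> 0 <= B ->
  cstable 1 k M P -> almost_malnormal P -> ga (- E) \notin P ->
  ga 0 = 1%g -> (forall t, - E <= t -> t <= 0 -> ga t \in Q) ->
  (forall t, 0 <= t -> t <= B -> ga t \in P) ->
  (forall t, - (A + E) <= t -> t <= - E -> ((ga (- E))^-1 * ga t)%g \in P) ->
  qgeo d 1 k (- (A + E)) (- E) ga -> qgeo d 1 k (- E) 0 ga -> qgeo d 1 k 0 B ga ->
  cmorse d M 0 B ga ->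
  qgeo d 3 (pair_const k M) (- (A + E)) 0 ga ->
  cmorse d (cat_gauge M) (- (A + E)) 0 ga ->
  (forall h, h \in Q -> h \in P ->
     d (ga (- E)) 1%g + d 1%g (ga B) <= d (ga (- E)) h + d h (ga B)) ->
  qgeo d 9 (triple_const k M) (- (A + E)) B ga /\
  cmorse d (cat_gauge (cat_gauge M)) (- (A + E)) B ga.
Proof.
move=> k0 A0 E0 B0 sP mal qP g0 gQ gP gP' q1 q2 q3 m3 q12 m12 hmin.
have k1 := pair_const_ge M k0.
have m3' : cmorse d (cat_gauge M) 0 B ga.
  by apply: cmorse_le m3 => *; exact: cat_gauge_le.
split; last by apply: (cmorse_cat dP gd) m12 m3'; lra.
set K0 := Num.max 0 (cat_gauge M 9 (pair_const k M + 5)).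
have K00 : 0 <= K0 by exact: max_ge0.
have C0 : 0 <= corner_const k K0 + malnormal_const k K0 M.
  by rewrite addr_ge0 ?corner_const_ge0 ?malnormal_const_ge0.
have q3' : qgeo d 1 (pair_const k M) 0 B ga.
  by apply: (qgeo_le dP _ _ _ _ q3); lra.
have X := @corner_qgeo 3 (pair_const k M) (cat_gauge M) (A + E) B
  (corner_const k K0 + malnormal_const k K0 M) ga _ _ _ B0 C0 q12 q3' m3'.
have E9 : 3 * 3 = 9 :> R by lra.
rewrite E9 -/K0 in X; apply: X; try lra.
move=> c c0 cAE fel.
have mn : Num.min c E <= corner_const k K0.
  apply: (@minimal_corner k K0 Q P E B (Num.min c E) ga) => //.
    by rewrite ge_min lexx orbT.
  by move=> u u0; rewrite le_min => /andP[uc _]; exact: fel.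
have mc := malnormal_const_ge0 K0 M k0.
case: (leP c E) mn => [_|Ec]; rewrite ?(min_idPl _) // => mn; first lra.
suff : c - E <= malnormal_const k K0 M by lra.
(* [al] is the first letter run backwards and translated into [P]; the same translation takes the
   last letter into the coset of [P] by [(ga (- E))^-1]. *)
pose al u := ((ga (- E))^-1 * ga (- u - E))%g.
have qP' : (ga (- E))^-1%g \notin P by rewrite gpredV.
apply: (@malnormal_corner k K0 M P (ga (- E))^-1%g A (c - E) al) => //; try lra.
- by move=> t ? ?; apply: gP'; lra.
- apply: qgeo_mul; have := qgeo_rev dP q1.
  rewrite !opprK => /(qgeo_sub (a' := E) (b' := A + E) (lexx _) (lexx _)) qr.
  have := @qgeo_shift R G d 1 k 0 A (- E) (fun t => ga (- t)).
  rewrite sub0r !opprK => /(_ qr) H.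
  by apply: qgeo_eq H => t _ _; congr (ga _); lra.
- move=> u u0 uc; have [||v vB Hv] := fel (u + E); order_lra.
  exists (ga v); first by apply: gP; lra.
  by rewrite /al dM; move: Hv; congr (d (ga _) _ <= _); lra.
Qed.

End GroupGeometry.

(** * Paths of alternating words *)

Section WordPath.
Context {R : realType} {G : groupType}.
Variables (d : G -> G -> R) (dP : is_pseudometric d) (gd : coarsely_geodesic d)
  (dM : forall g x y, d (g * x)%g (g * y)%g = d x y)
  (ball : R -> seq G) (ballP : forall r x, d 1%g x <= r -> x \in ball r).
Variables (P Q : groupClosed G) (k : R) (M : R -> R -> R) (k0 : 0 <= k).
Variables (sP : cstable d 1 k M P).

Let dxx x : d x x = 0. Proof. by case: dP. Qed.
Let dC x y : d x y = d y x. Proof. by case: dP. Qed.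
Let dD x y z : d x z <= d x y + d y z. Proof. by case: dP => ? ?; apply. Qed.
Let d0 x y : 0 <= d x y.
Proof. by have := dD x y x; rewrite dxx (dC y x); lra. Qed.

Definition side (x : G) : groupClosed G := if x \in P then P else Q.

Lemma sideP x : (x \in P) || (x \in Q) -> x \in side x.
Proof. by rewrite /side; case: ifP => //= ->. Qed.

Variables (len : G -> R) (pth : G -> R -> G).
Hypothesis pthP : forall x, (x \in P) || (x \in Q) ->
  [/\ 0 <= len x, pth x 0 = 1%g /\ pth x (len x) = x,
    (forall t, 0 <= t -> t <= len x -> pth x t \in side x),
    qgeo d 1 k 0 (len x) (pth x) & cmorse d M 0 (len x) (pth x)].

Fixpoint wpath (x : G) (w : seq G) (t : R) : G :=
  if w is a :: w' then
    if t <= len a then (x * pth a t)%g else wpath (x * a)%g w' (t - len a)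
  else x.

Fixpoint wlen (w : seq G) : R := if w is a :: w' then len a + wlen w' else 0.

Definition corner (a b : G) := [/\ a \in P != (a \in Q), b \in P != (b \in Q),
  a \in P != (b \in P) & forall h, h \in P -> h \in Q ->
  d 1%g a + d 1%g b <= d 1%g (a * h)%g + d 1%g (h^-1 * b)%g].

Fixpoint tight (w : seq G) : Prop := if w is a :: w' then
  [/\ (a \in P) || (a \in Q), (if w' is b :: _ then corner a b else True) & tight w']
  else True.

(** These are the constants of [triple_geo]; they are weak enough to cover windows meeting one or
    two letters as well. *)
Definition good a b f := qgeo d 9 (triple_const ball k M) a b f /\
  cmorse d (cat_gauge (cat_gauge M)) a b f.

Let kp : k <= pair_const ball k M.
Proof. exact: pair_const_ge. Qed.
Let kt : pair_const ball k M <= triple_const ball k M.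
Proof. exact: triple_const_ge. Qed.

Lemma good_sub a b a' b' f : a <= a' -> b' <= b -> good a b f -> good a' b' f.
Proof. by move=> aa bb [q m]; split; [exact: qgeo_sub q|exact: cmorse_sub m]. Qed.

Lemma good_eq a b f g : (forall t, a <= t -> t <= b -> f t = g t) ->
  good a b f -> good a b g.
Proof. by move=> fg [q m]; split; [exact: qgeo_eq fg q|exact: cmorse_eq fg m]. Qed.

Lemma good_shift a b c f : good (a - c) (b - c) f -> good a b (fun t => f (t - c)).
Proof. by move=> [q m]; split; [exact: qgeo_shift q|exact: cmorse_shift m]. Qed.

Lemma good_mul a b f g : good a b f -> good a b (fun t => g * f t)%g.
Proof. by move=> [q m]; split; [apply: qgeo_mul q|apply: cmorse_mul m]. Qed.

Lemma good_single a b f : qgeo d 1 k a b f -> cmorse d M a b f -> good a b f.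
Proof.
move=> q m; split; first by apply: (qgeo_le dP _ _ _ _ q); move: kp kt k0; lra.
by apply: cmorse_le m => *; apply: le_trans (cat_gauge_le _ _ _) (cat_gauge_le _ _ _).
Qed.

Lemma corner_union a b : corner a b -> ((a \in P) || (a \in Q)) /\ ((b \in P) || (b \in Q)).
Proof.
by move=> [+ + _ _]; case: (a \in P); case: (a \in Q); case: (b \in P); case: (b \in Q).
Qed.

(** The path is translated to have its corner at [1] at time 0, as in [pair_geo]. *)
Definition pair_path (a b : G) (u : R) : G :=
  if u <= 0 then (a^-1 * pth a (u + len a))%g else pth b u.

Lemma pair_pathl a b u : u <= 0 -> pair_path a b u = (a^-1 * pth a (u - - len a))%g.
Proof. by rewrite /pair_path opprK => ->. Qed.

Lemma pair_pathr a b u : corner a b -> 0 <= u -> pair_path a b u = pth b u.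
Proof.
move=> /corner_union[/pthP[_ [_ al] _ _ _] /pthP[_ [b0 _] _ _ _]].
rewrite /pair_path le_eqVlt => /orP[/eqP<-|]; last by rewrite ltNge => /negbTE->.
by rewrite lexx add0r al b0 mulVg.
Qed.

Lemma path_back a : (a \in P) || (a \in Q) ->
  let f u := (a^-1 * pth a (u - - len a))%g in
  [/\ qgeo d 1 k (- len a) 0 f, cmorse d M (- len a) 0 f &
  forall u, - len a <= u -> u <= 0 -> f u \in side a].
Proof.
move=> aPQ; have [la [a0 al] aS aq am] := pthP aPQ; split.
- apply: qgeo_mul => //; apply: (@qgeo_shift R G d 1 k (- len a) 0 (- len a)).
  by rewrite subrr sub0r opprK.
- apply: cmorse_mul => //; apply: (@cmorse_shift R G d M (- len a) 0 (- len a)).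
  by rewrite subrr sub0r opprK.
- move=> u u1 u2; rewrite gpredM ?gpredV ?sideP // aS //; lra.
Qed.

Lemma pair_good a b : corner a b ->
  qgeo d 3 (pair_const ball k M) (- len a) (len b) (pair_path a b) /\
  cmorse d (cat_gauge M) (- len a) (len b) (pair_path a b).
Proof.
move=> cab; have [aPQ bPQ] := corner_union cab; have [ca cb ab hmin] := cab.
have [la [a0 al] aS aq am] := pthP aPQ; have [lb [b0 bl] bS bq bm] := pthP bPQ.
have [bkq bkm bkS] := path_back aPQ.
have El u : - len a <= u -> u <= 0 -> (a^-1 * pth a (u - - len a))%g = pair_path a b u.
  by move=> _ u0; rewrite pair_pathl.
have Er u : 0 <= u -> u <= len b -> pth b u = pair_path a b u.
  by move=> u0 _; rewrite pair_pathr.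
have pl : pair_path a b (- len a) = a^-1%g.
  by rewrite pair_pathl ?subrr ?a0 ?mulg1 //; lra.
have pr : pair_path a b (len b) = b by rewrite pair_pathr.
apply: (@pair_geo R G d dP gd dM ball ballP k M (side a) (side b)) => //.
- by rewrite pair_pathr.
- by move=> t t1 t2; rewrite -El ?bkS.
- by move=> t t1 t2; rewrite -Er ?bS.
- exact: qgeo_eq El bkq.
- exact: qgeo_eq Er bq.
- exact: cmorse_eq El bkm.
- exact: cmorse_eq Er bm.
move=> h ha hb; rewrite pl pr.
have [hP hQ] : h \in P /\ h \in Q.
  move: ab ha hb; rewrite /side; case: (a \in P); case: (b \in P) => //= _ ha hb; split.
have := hmin h hP hQ; rewrite !(dist1 dM, dC _ 1%g).
have -> : d 1%g a^-1%g = d 1%g a by rewrite -(dM a) mulgV mulg1 dC.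
have -> : d a^-1%g h = d 1%g (a * h)%g by rewrite -(dM a) mulgV.
by [].
Qed.

Definition triple_path (a b c : G) (u : R) : G :=
  if u <= 0 then (b^-1 * pair_path a b (u - - len b))%g else pth c u.

Lemma triple_good a b c : almost_malnormal P -> b \notin P -> corner a b -> corner b c ->
  good (- (len a + len b)) (len c) (triple_path a b c).
Proof.
move=> mal bP cab cbc; have [q12 m12] := pair_good cab.
have [aPQ bPQ] := corner_union cab; have [_ cPQ] := corner_union cbc.
have aP : a \in P by have [_ _ + _] := cab; rewrite (negbTE bP); case: (a \in P).
have cP : c \in P by have [_ _ + _] := cbc; rewrite (negbTE bP); case: (c \in P).
have [la [a0 al] aS aq am] := pthP aPQ; have [lb [b0 bl] bS bq bm] := pthP bPQ.
have [lc [c0 cl] cS cq cm] := pthP cPQ; have [_ _ _ hmin] := cbc.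
have [bkq bkm bkS] := path_back bPQ; have [akq akm akS] := path_back aPQ.
have sa : side a = P by rewrite /side aP.
have sc : side c = P by rewrite /side cP.
have sb : side b = Q by rewrite /side (negbTE bP).
rewrite sa in aS akS; rewrite sb in bS bkS; rewrite sc in cS.
set ga := triple_path a b c.
have Er u : 0 <= u -> u <= len c -> pth c u = ga u.
  rewrite /ga /triple_path => + _.
  rewrite le_eqVlt => /orP[/eqP<-|]; last by rewrite ltNge => /negbTE->.
  by rewrite lexx sub0r opprK pair_pathr // bl c0 mulVg.
have E12 u : - (len a + len b) <= u -> u <= 0 ->
    (b^-1 * pair_path a b (u - - len b))%g = ga u.
  by rewrite /ga /triple_path => _ ->.
have E2 u : - len b <= u -> u <= 0 -> (b^-1 * pth b (u - - len b))%g = ga u.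
  by move=> u1 u2; rewrite -E12 ?pair_pathr //; lra.
have E1 u : - (len a + len b) <= u -> u <= - len b ->
    (b^-1 * (a^-1 * pth a (u - - len b - - len a)))%g = ga u.
  by move=> u1 u2; rewrite -E12 ?pair_pathl //; lra.
have gb : ga (- len b) = b^-1%g by rewrite -E2 ?subrr ?b0 ?mulg1 //; lra.
have gc : ga (len c) = c by rewrite -Er.
apply: (@triple_geo R G d dP gd dM ball ballP k M P Q (len a) (len b) (len c)) => //.
- by rewrite gb gpredV.
- by rewrite -Er.
- by move=> t t1 t2; rewrite -E2 ?bkS.
- by move=> t t1 t2; rewrite -Er ?cS.
- move=> t t1 t2; rewrite gb invgK -E1 // mulVKg; apply: akS; lra.
- apply: qgeo_eq E1 _; apply: qgeo_mul => //.
  apply: (@qgeo_shift R G d 1 k _ _ (- len b) (fun u => a^-1 * pth a (u - - len a))%g).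
  by apply: qgeo_sub akq; lra.
- exact: qgeo_eq E2 bkq.
- exact: qgeo_eq Er cq.
- exact: cmorse_eq Er cm.
- apply: qgeo_eq E12 _; apply: qgeo_mul => //; apply: qgeo_shift.
  by apply: qgeo_sub q12; lra.
- apply: cmorse_eq E12 _; apply: cmorse_mul => //; apply: cmorse_shift.
  by apply: cmorse_sub m12; lra.
move=> h hQ hP; rewrite gb gc.
have := hmin h hP hQ; rewrite !(dist1 dM, dC _ 1%g).
have -> : d 1%g b^-1%g = d 1%g b by rewrite -(dM b) mulgV mulg1 dC.
have -> : d b^-1%g h = d 1%g (b * h)%g by rewrite -(dM b) mulgV.
by [].
Qed.

Lemma wpath0 x w : tight w -> wpath x w 0 = x.
Proof. by case: w => //= a w [/pthP[la [a0 _] _ _ _] _ _]; rewrite la a0 mulg1. Qed.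

Lemma wlen_ge0 w : tight w -> 0 <= wlen w.
Proof. by elim: w => //= a w IH [/pthP[la _ _ _ _] _ /IH]; lra. Qed.

Lemma wpath_cons x a w t : tight (a :: w) -> len a <= t ->
  wpath x (a :: w) t = wpath (x * a)%g w (t - len a).
Proof.
move=> /= [/pthP[la [a0 al] _ _ _] _ tw].
rewrite le_eqVlt => /orP[/eqP<-|]; last by rewrite ltNge => /negbTE->.
by rewrite lexx al subrr wpath0.
Qed.

Lemma wpath_end x w : tight w -> wpath x w (wlen w) = (x * \prod_(a <- w) a)%g.
Proof.
elim: w x => [|a w IH] x tw; first by rewrite big_nil mulg1.
have [_ _ tw'] := tw; rewrite wpath_cons //=; last by have := wlen_ge0 tw'; lra.
by rewrite (addrC (len a)) addrK IH // big_cons mulgA.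
Qed.

Lemma wpath_mem x w t (J : groupClosed G) : {subset P <= J} -> {subset Q <= J} ->
  tight w -> x \in J -> 0 <= t -> t <= wlen w -> wpath x w t \in J.
Proof.
move=> PJ QJ; elim: w x t => [|a w IH] x t //= [aPQ _ tw] xJ t0 tw'.
have [la [a0 al] aS _ _] := pthP aPQ.
case: leP => ta; last first.
  apply: IH => //; try lra.
  by rewrite gpredM //; case/orP: aPQ => ?; [exact: PJ|exact: QJ].
rewrite gpredM //; have := aS t t0 ta; rewrite /side.
by case: ifP => _ ?; [exact: PJ|exact: QJ].
Qed.

(** Letters that end before [s] are removed by induction. The window then meets one letter, or two,
    or three if it passes over a whole letter; a letter passed over is shorter than [L], so it is
    outside [P], its successor is in [P], and the window ends on that successor. *)
Lemma wpath_window L w x s t : tight w ->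
  (forall a, a \in w -> a \in P -> L < len a) ->
  almost_malnormal P \/ (forall a, a \in w -> L < len a) ->
  0 <= s -> s <= t -> t <= wlen w -> t - s <= L -> w != [::] ->
  good s t (wpath x w).
Proof.
elim: w x s t => [|a w IH] x s t // tw lP lQ s0 st tw' sL _.
have /= [aPQ cw tww] := tw.
have [la [a0 al] aS aq am] := pthP aPQ.
case: (leP t (len a)) => ta.
  apply: (@good_eq _ _ (fun t => x * pth a t)%g).
    by move=> u _ ut /=; rewrite (le_trans ut ta).
  apply: good_mul; apply: good_single.
    by apply: qgeo_sub aq; lra.
  by apply: cmorse_sub am; lra.
have wn0 : w != [::] by apply: contraTneq tw' => ->; rewrite /= -ltNge; lra.
case: (leP (len a) s) => sa.
  apply: (@good_eq _ _ (fun t => wpath (x * a)%g w (t - len a))).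
    by move=> u su _; rewrite -[RHS]/(wpath x (a :: w) u) wpath_cons //; lra.
  apply: good_shift; apply: IH => //; rewrite /= in tw'; try lra.
    by move=> b bw; apply: lP; rewrite inE bw orbT.
  by case: lQ => H; [left|right => b bw; apply: H; rewrite inE bw orbT].
case: w wn0 IH tw lP lQ tw' cw tww => // b w _ _ tw lP lQ tw' cab tww.
have [_ cw tw2] := tww; have [_ bPQ] := corner_union cab.
have [lb [b0 bl] bS bq bm] := pthP bPQ.
have [q2 m2] := pair_good cab.
case: (leP t (len a + len b)) => tab.
  apply: (@good_eq _ _ (fun t => x * a * pair_path a b (t - len a))%g).
    move=> u su ut; case: (leP u (len a)) => ua.
      by rewrite pair_pathl ?subr_le0 // opprK subrK -mulgA mulVKg.
    rewrite /= ifT; last lra.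
    by rewrite pair_pathr //; lra.
  apply: good_mul; apply: good_shift.
  apply: (@good_sub (- len a) (len b)); try lra.
  split; first by apply: (qgeo_le dP _ _ _ _ q2); move: kp kt k0; lra.
  by apply: cmorse_le m2 => *; exact: cat_gauge_le.
(* The window contains all of [b], so [b] is short; this leaves only the almost malnormal case, with
   neighbours of [b] in [P]. *)
have bL : len b < L by lra.
have bP : b \notin P.
  by apply/negP => bP; have := lP b; rewrite !inE eqxx orbT => /(_ erefl bP); lra.
case: lQ => [mal|H]; last first.
  by have := H b; rewrite !inE eqxx orbT => /(_ erefl); lra.
case: w tw lP tw' cw tww tw2 => [|c w] tw lP tw' cbc tww tw2.
  by rewrite /= in tw'; lra.
have [_ cPQ] := corner_union cbc.
have cP : c \in P by have [_ _ + _] := cbc; rewrite (negbTE bP); case: (c \in P).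
have lc : L < len c by apply: lP => //; rewrite !inE eqxx !orbT.
apply: (@good_eq _ _ (fun t => x * a * b * triple_path a b c (t - (len a + len b)))%g).
  move=> u su ut; rewrite /triple_path.
  case: (leP u (len a)) => ua.
    rewrite ifT; last lra.
    have -> : u - (len a + len b) - - len b = u - len a by lra.
    by rewrite pair_pathl ?subr_le0 // opprK subrK -!mulgA !mulVKg.
  rewrite /=.
  case: (leP (u - len a) (len b)) => ub.
    rewrite ifT; last lra.
    have -> : u - (len a + len b) - - len b = u - len a by lra.
    by rewrite pair_pathr ?subr_ge0 ?(ltW ua) // -!mulgA mulVKg.
  rewrite ifF; last by apply/negbTE; rewrite -ltNge; lra.
  by rewrite ifT; [rewrite opprD addrA|lra].
apply: good_mul; apply: good_shift.
by apply: (good_sub _ _ (triple_good mal bP cab cbc)); lra.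
Qed.

End WordPath.

(** * Alternating words and the amalgam *)

Section ReducedWords.
Context {G : groupType} (P Q : groupClosed G).
Local Open Scope group_scope.

Definition letter (x : G) : bool := (x \in P) != (x \in Q).
Definition alternate (a b : G) : bool := (a \in P) != (b \in P).
Definition reduced (w : seq G) : bool := all letter w && sorted alternate w.

(** Being reduced depends only on the membership pattern of the letters, which multiplication by
    elements of the intersection preserves. *)
Lemma reducedE w : reduced w =
  all (fun p => p.1 != p.2) [seq (x \in P, x \in Q) | x <- w] &&
  sorted (fun p q => p.1 != q.1) [seq (x \in P, x \in Q) | x <- w].
Proof. by rewrite /reduced all_map sorted_map. Qed.

Lemma reduced_mull k a w : k \in P -> k \in Q ->
  reduced (a :: w) -> reduced (k * a :: w).
Proof. by move=> kP kQ; rewrite !reducedE /= !gpredMl. Qed.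

Lemma join_memP x : x \in P -> x \in joinG P Q.
Proof.
move=> xP; apply/asboolP; exists [:: x]; last by rewrite big_seq1.
by rewrite /is_word /= inE /= xP.
Qed.

Lemma join_memQ x : x \in Q -> x \in joinG P Q.
Proof.
move=> xQ; apply/asboolP; exists [:: x]; last by rewrite big_seq1.
by rewrite /is_word /= inE /= xQ orbT.
Qed.

Notation letterT := (subgroup_type P + subgroup_type Q)%type.
Notation iL := (@inter_inl G P Q).
Notation iR := (@inter_inr G P Q).
Notation am_eq := (@amalgam_eq _ _ _ iL iR).

Definition eval (c : letterT) : G := match c with inl a => val a | inr b => val b end.
Definition evalw (u : seq letterT) : G := \prod_(c <- u) eval c.

Lemma evalw_cat u v : evalw (u ++ v) = evalw u * evalw v.
Proof. exact: big_cat. Qed.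

Lemma evalw_eq u v : am_eq u v -> evalw u = evalw v.
Proof.
elim=> //.
- by move=> {}u {}v w _ -> _ ->.
- by move=> {}u u' {}v v' _ uE _ vE; rewrite !evalw_cat uE vE.
- by rewrite /evalw big_seq1 big_nil.
- by rewrite /evalw big_seq1 big_nil.
- by move=> a a'; rewrite /evalw !big_cons !big_nil !mulg1.
- by move=> a a'; rewrite /evalw !big_cons !big_nil !mulg1.
- by move=> k; rewrite /evalw !big_seq1.
Qed.

Lemma evalw_join u : evalw u \in joinG P Q.
Proof.
apply: gpred_prod => -[a|b] _; [exact: join_memP (valP a)|exact: join_memQ (valP b)].
Qed.

Lemma join_evalw x : x \in joinG P Q -> exists u, evalw u = x.
Proof.
move=> /asboolP[w ww <-]; elim: w ww => [|s w IH] /=.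
  by exists [::]; rewrite /evalw !big_nil.
move=> /andP[sPQ /IH[u uE]].
have [c cE] : exists c, eval c = s.
  have : (s \in P) || (s \in Q).
    by move: sPQ; rewrite !inE /= !gpredV orbb.
  case/orP => sS; first by exists (inl (Sub s sS)).
  by exists (inr (Sub s sS)).
by exists (c :: u); rewrite /evalw !big_cons cE -uE.
Qed.

Lemma am_cons c u v : am_eq u v -> am_eq (c :: u) (c :: v).
Proof. by move=> uv; apply: (amalgam_cat (amalgam_refl _ _ [:: c]) uv). Qed.

Lemma am_head u u' v : am_eq u u' -> am_eq (u ++ v) (u' ++ v).
Proof. by move=> uu; apply: amalgam_cat uu (amalgam_refl _ _ v). Qed.

Lemma am_one v : am_eq v (inl (iL 1) :: v).
Proof.
have -> : iL 1 = 1 by exact: val_inj.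
apply: amalgam_sym; exact: (@am_head [:: inl 1] [::] v (amalgam_1l _ _)).
Qed.

Lemma am_inter c : eval c \in P -> eval c \in Q ->
  exists k, am_eq [:: c] [:: inl (iL k)].
Proof.
move=> cP cQ; have cPQ : eval c \in interG P Q by rewrite inE /= cP cQ.
exists (Sub (eval c) cPQ); case: c cP cQ cPQ => [a|b] cP cQ cPQ.
  have -> : iL (Sub (eval (inl a)) cPQ) = a by exact: val_inj.
  exact: amalgam_refl.
have {1}-> : b = iR (Sub (eval (inr b)) cPQ) by exact: val_inj.
exact/amalgam_sym/amalgam_glue.
Qed.

(** Letters on the same side carry the same tag, since a letter tagged by the other subgroup would
    lie in both. *)
Lemma am_merge c c' : letter (eval c) -> letter (eval c') ->
  (eval c \in P) = (eval c' \in P) ->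
  exists2 c'', am_eq [:: c; c'] [:: c''] & eval c'' = eval c * eval c'.
Proof.
case: c => [a|a]; case: c' => [b|b] la lb ab.
- by exists (inl (a * b)) => //; exact: amalgam_Ml.
- have bP : eval (inr b) \in P by rewrite -ab; exact: valP a.
  have bQ : eval (inr b) \in Q by exact: valP b.
  by move: lb; rewrite /letter bP bQ.
- have aP : eval (inr a) \in P by rewrite ab; exact: valP b.
  have aQ : eval (inr a) \in Q by exact: valP a.
  by move: la; rewrite /letter aP aQ.
- by exists (inr (a * b)) => //; exact: amalgam_Mr.
Qed.

Lemma letterN x : (x \in P) || (x \in Q) -> ~~ letter x -> (x \in P) && (x \in Q).
Proof. by rewrite /letter negbK => + /eqP xx; rewrite xx orbb => ->. Qed.

Lemma eval_union c : (eval c \in P) || (eval c \in Q).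
Proof. by apply/orP; case: c => [a|b]; [left|right]; exact: valP. Qed.

(** Either [c] is in the intersection, or it can be put in front of [v] as it is, or it merges with
    the head of [v]. The merged letter is again in the intersection or remains on the same side as
    the head. *)
Lemma am_reduce c v : reduced [seq eval c | c <- v] ->
  exists k v', am_eq (c :: v) (inl (iL k) :: v') /\
    reduced [seq eval c | c <- v'].
Proof.
move=> rv; have [lc|] := boolP (letter (eval c)); last first.
  move=> /(letterN (eval_union c)) /andP[cP cQ].
  have [k ck] := am_inter cP cQ; exists k, v; split => //.
  exact: (@am_head [:: c] [:: inl (iL k)] v).
case: v rv => [|b v] rv.
  by exists 1, [:: c]; split; [exact: am_one|rewrite /reduced /= lc].
have [cb|] := boolP (alternate (eval c) (eval b)).
  exists 1, [:: c, b & v]; split; first exact: am_one.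
  by move: rv; rewrite /reduced /= => /andP[-> ->]; rewrite lc cb.
rewrite /alternate negbK => /eqP cb.
have lb : letter (eval b) by move: rv; rewrite /reduced /= => /andP[/andP[]].
have [e ee eE] := am_merge lc lb cb.
have ev : am_eq [:: c, b & v] (e :: v) by exact: (@am_head [:: c; b] [:: e] v).
have [le|] := boolP (letter (eval e)); last first.
  move=> /(letterN (eval_union e)) /andP[eP eQ].
  have [k ek] := am_inter eP eQ; exists k, v; split; last first.
    by move: rv; rewrite /reduced /= => /andP[/andP[_ ->]] /path_sorted ->.
  exact: amalgam_trans ev (@am_head [:: e] [:: inl (iL k)] v ek).
have eb : (eval e \in P) = (eval b \in P).
  have [bP|bP] := boolP (eval b \in P); first by rewrite eE gpredMr // cb.
  have bQ : eval b \in Q by move: lb; rewrite /letter (negbTE bP); case: (_ \in Q).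
  have cQ : eval c \in Q by move: lc; rewrite /letter cb (negbTE bP); case: (_ \in Q).
  by apply: contraTF le => eP; rewrite /letter eP eE gpredM.
exists 1, (e :: v); split; first exact: amalgam_trans ev (am_one _).
move: rv; rewrite /reduced /= le => /andP[/andP[_ ->]].
by case: (v) => //= v0 v1; rewrite /alternate eb.
Qed.

(** In the induction the element [k] of the intersection in front of the tail is absorbed by the
    next letter, through the gluing relation if that letter is tagged by [Q]. *)
Lemma am_normal u : exists k v, am_eq u (inl (iL k) :: v) /\
  reduced [seq eval c | c <- v].
Proof.
elim: u => [|c u [k [v [uv rv]]]]; first by exists 1, [::]; split; [exact: am_one|].
have [c' cc'] : exists c', am_eq [:: c; inl (iL k)] [:: c'].
  case: c => [a|b]; first by exists (inl (a * iL k)); exact: amalgam_Ml.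
  exists (inr (b * iR k)); apply: amalgam_trans (amalgam_Mr _ _ _ _).
  by apply: am_cons; exact: amalgam_glue.
have [k' [v' [v'E rv']]] := am_reduce c' rv.
exists k', v'; split => //; apply: amalgam_trans v'E.
apply: amalgam_trans (am_cons c uv) _.
exact: (@am_head [:: c; inl (iL k)] [:: c'] v).
Qed.

Lemma join_normal x : x \in joinG P Q -> (x \in P) && (x \in Q) \/
  exists w, [/\ w != [::], reduced w & \prod_(a <- w) a = x].
Proof.
move=> /join_evalw[u <-]; have [k [v [uv rv]]] := am_normal u.
have kPQ := valP k; rewrite inE /= in kPQ; have /andP[kP kQ] := kPQ.
rewrite (evalw_eq uv) /evalw big_cons /=; case: v rv {uv} => [|c v] rv.
  by left; rewrite big_nil mulg1 kP kQ.
right; exists (val k * eval c :: [seq eval c | c <- v]); split => //.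
  exact: reduced_mull.
by rewrite !big_cons big_map mulgA.
Qed.

(** An element is sent to the class of any word with this value, and evaluation is the inverse. Two
    words with the same value are equivalent as soon as a word of value 1 is trivial; its normal
    form is an element of the intersection, or else gives a nonempty reduced word of product 1,
    which is excluded. *)
Lemma amalgam_iso :
  (forall w, w != [::] -> reduced w -> \prod_(a <- w) a <> 1) ->
  isomorphic (subgroup_type (joinG P Q)) (amalgam_inter P Q).
Proof.
move=> red1.
have ev1 u : evalw u = 1 -> am_eq u [::].
  have [k [v [uv rv]]] := am_normal u.
  have kPQ := valP k; rewrite inE /= in kPQ; have /andP[kP kQ] := kPQ.
  move=> u1; have := evalw_eq uv; rewrite u1 /evalw big_cons /=.
  case: v rv uv => [|c v] rv uv E.
    apply: amalgam_trans uv _; have -> : k = 1.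
      by apply: val_inj; rewrite /= E big_nil mulg1.
    exact: amalgam_sym (am_one _).
  have [] := red1 (val k * eval c :: [seq eval c | c <- v]) isT (reduced_mull kP kQ rv).
  by rewrite big_cons big_map -mulgA [RHS]E big_cons.
have evI u v : evalw u = evalw v -> am_eq u v.
  move=> uv; pose V := amalgam_wordV v.
  have Vv : am_eq (V ++ v) [::] by exact: amalgam_wordVl.
  have uV : am_eq (u ++ V) [::].
    apply: ev1; rewrite evalw_cat uv; apply: (mulIg (evalw v)).
    by rewrite -mulgA -evalw_cat (evalw_eq Vv) /evalw big_nil mulg1 mul1g.
  apply: (@amalgam_trans _ _ _ _ _ (u ++ (V ++ v))).
    rewrite -[X in am_eq X]cats0; apply: amalgam_cat; first exact: amalgam_refl.
    exact: amalgam_sym.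
  by rewrite catA; exact: (am_head v uV).
have /choice[h hE] : forall x : subgroup_type (joinG P Q), exists u, evalw u = val x.
  by move=> x; exact: join_evalw (valP x).
pose f (x : subgroup_type (joinG P Q)) : amalgam_inter P Q := amalgam_class _ _ (h x).
have fM : {morph f : x y / x * y}.
  move=> x y; rewrite /f -[RHS]/(amalgam_mul _ _) amalgam_mulE.
  by apply/amalgam_classP/evI; rewrite evalw_cat !hE.
pose F : {multiplicative subgroup_type (joinG P Q) -> amalgam_inter P Q} :=
  HB.pack f (isMultiplicative.Build _ _ f fM).
exists F; exists (fun X : amalgam_inter P Q => Sub (evalw (repr X)) (evalw_join _)).
  by move=> x; apply: val_inj; rewrite /= -hE; apply: evalw_eq; exact: amalgam_reprE.
move=> X; rewrite -[RHS]amalgam_reprK; apply/amalgam_classP/evI.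
by rewrite hE.
Qed.

End ReducedWords.

(** * Tight words and the combination theorem *)

Section Combination.
Context {R : realType} {G : groupType}.
Variables (d : G -> G -> R) (dP : is_pseudometric d) (gd : coarsely_geodesic d)
  (dM : forall g x y, d (g * x)%g (g * y)%g = d x y)
  (ball : R -> seq G) (ballP : forall r x, d 1%g x <= r -> x \in ball r)
  (wl : G -> nat) (dwl : forall x, d 1%g x = (wl x)%:R).
Variables (P Q : groupClosed G).

Lemma reduced_behead a w : reduced P Q (a :: w) -> reduced P Q w.
Proof. by rewrite /reduced /= => /andP[/andP[_ ->]] /path_sorted ->. Qed.

Lemma letter_union x : letter P Q x -> (x \in P) || (x \in Q).
Proof. by rewrite /letter; case: (x \in P); case: (x \in Q). Qed.

Lemma not_tight w : reduced P Q w -> tight d P Q w \/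
  exists u a b v h, [/\ w = u ++ [:: a, b & v], h \in P, h \in Q &
    (wl (a * h)%g + wl (h^-1 * b)%g < wl a + wl b)%N].
Proof.
elim: w => [|a w IH] rw; first by left.
have [tw|[u [a' [b [v [h [-> hP hQ hlt]]]]]]] := IH (reduced_behead rw); last first.
  by right; exists (a :: u), a', b, v, h.
have la : letter P Q a by move: rw; rewrite /reduced /= => /andP[/andP[]].
case: w IH rw tw => [|b w] _ rw tw; first by left; split => //; exact: letter_union.
have lb : letter P Q b by move: rw; rewrite /reduced /= => /andP[/and3P[]].
have ab : alternate P a b by move: rw; rewrite /reduced /= => /andP[_ /andP[]].
have [[h [hP hQ hlt]]|H] := pselect (exists h, [/\ h \in P, h \in Q &
    (wl (a * h)%g + wl (h^-1 * b)%g < wl a + wl b)%N]).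
  by right; exists [::], a, b, w, h.
left; split => //; first exact: letter_union.
split => // h hP hQ; rewrite !dwl -!natrD ler_nat leqNgt.
by apply/negP => hlt; apply: H; exists h.
Qed.

(** Each replacement of [a], [b] by [a * h], [h^-1 * b] lowers the total word length, a natural
    number, and keeps the membership pattern. *)
Lemma tighten w : reduced P Q w -> exists w', [/\ tight d P Q w',
  reduced P Q w', size w' = size w & (\prod_(a <- w') a = \prod_(a <- w) a)%g].
Proof.
have [n] := ubnP (\sum_(a <- w) wl a)%N; elim: n w => // n IH w.
rewrite ltnS => wn rw.
have [tw|[u [a [b [v [h [wE hP hQ hlt]]]]]]] := not_tight rw; first by exists w.
have [||w' [tw' rw' sw' pw']] := IH (u ++ [:: a * h, h^-1 * b & v])%g.
- apply: leq_trans wn; rewrite wE !big_cat !big_cons /= ltn_add2l !addnA.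
  by rewrite ltn_add2r.
- move: rw; rewrite wE !reducedE !map_cat /=.
  by rewrite (gpredMr _ hP) (gpredMr _ hQ) !gpredMl // gpredV.
- exists w'; split => //; first by rewrite sw' wE !size_cat.
  rewrite pw' wE !big_cat !big_cons /=; congr (_ * _)%g.
  by rewrite !mulgA mulgK.
Qed.

Variables (k : R) (M : R -> R -> R) (k0 : 0 <= k).
Variables (sP : cstable d 1 k M P) (sQ : cstable d 1 k M Q).
Variables (L l' k' : R) (M' : R -> R -> R) (L0 : 0 < L) (l'1 : 1 <= l') (k'0 : 0 <= k').
Hypothesis local_global : forall (a b : R) f, a <= b ->
  (forall s t, a <= s -> s <= t -> t <= b -> t - s <= L -> good d ball k M s t f) ->
  qgeo d l' k' a b f /\ cmorse d M' a b f.
Hypothesis Plong : forall x, x \in P -> x \notin Q -> L + l' * k' + k < d 1%g x.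
Hypothesis malQ : almost_malnormal P \/
  (forall x, x \in Q -> x \notin P -> L + l' * k' + k < d 1%g x).

Lemma choose_paths : exists (len : G -> R) (pth : G -> R -> G),
  forall x, (x \in P) || (x \in Q) ->
  [/\ 0 <= len x, pth x 0 = 1%g /\ pth x (len x) = x,
    (forall t, 0 <= t -> t <= len x -> pth x t \in side P Q x),
    qgeo d 1 k 0 (len x) (pth x) & cmorse d M 0 (len x) (pth x)].
Proof.
suff /choice[f fP] : forall x, exists p : R * (R -> G), (x \in P) || (x \in Q) ->
    [/\ 0 <= p.1, p.2 0 = 1%g /\ p.2 p.1 = x,
      (forall t, 0 <= t -> t <= p.1 -> p.2 t \in side P Q x),
      qgeo d 1 k 0 p.1 p.2 & cmorse d M 0 p.1 p.2].
  by exists (fun x => (f x).1), (fun x => (f x).2).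
move=> x; have [xPQ|_] := boolP ((x \in P) || (x \in Q)); last by exists (0, fun=> 1%g).
have sS : cstable d 1 k M (side P Q x) by rewrite /side; case: ifP.
have [A [al H]] := sS x (sideP xPQ).
by exists (A, al) => _; exact: H.
Qed.

Lemma reduced_path w : w != [::] -> reduced P Q w ->
  exists (A : R) (al : R -> G), [/\ 0 <= A,
    al 0 = 1%g /\ al A = (\prod_(a <- w) a)%g,
    (forall t, 0 <= t -> t <= A -> al t \in joinG P Q),
    qgeo d l' k' 0 A al /\ cmorse d M' 0 A al &
    (1 < size w)%N -> l' * k' < A].
Proof.
move=> wn /tighten[w' [tw rw sw <-]].
have {wn} wn : w' != [::] by rewrite -size_eq0 sw size_eq0.
rewrite -{}sw; have [len [pth pthP]] := choose_paths.
move: L0 k0 l'1 k'0 => L0' k0' l'1' k'0'.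
have l'k' : 0 <= l' * k' by apply: mulr_ge0 => //; move: l'1; lra.
have long x : (x \in P) || (x \in Q) -> d 1%g x <= len x + k.
  move=> /pthP[lx [x0 xl] _ xq _]; have [||| U _] := xq 0 (len x); order_lra.
  by rewrite x0 xl in U; lra.
have lw a : a \in w' -> letter P Q a.
  by move: rw; rewrite /reduced => /andP[/allP H _]; exact: H.
have lP a : a \in w' -> a \in P -> L + l' * k' < len a.
  move=> aw aP; have := lw _ aw; rewrite /letter aP; case: (boolP (a \in Q)) => // aQ _.
  by have := Plong aP aQ; have := long a; rewrite aP => /(_ isT); lra.
have lQ : almost_malnormal P \/ forall a, a \in w' -> L < len a.
  case: malQ => [|H]; [by left|right => a aw].
  have [aP|aP] := boolP (a \in P); first by have := lP a aw aP; lra.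
  have := lw _ aw; rewrite /letter (negbTE aP).
  case: (boolP (a \in Q)) => // aQ _.
  by have := H a aQ aP; have := long a; rewrite aQ orbT => /(_ isT); lra.
have wl0 := wlen_ge0 pthP tw.
exists (wlen len w'), (wpath len pth 1%g w'); split => //.
- by rewrite (wpath0 pthP) // (wpath_end pthP) // mul1g.
- move=> t t0 tw'; apply: (wpath_mem pthP) tw _ t0 tw'; last exact: gpred1.
    by move=> x; exact: join_memP.
  by move=> x; exact: join_memQ.
- apply: local_global => // s t s0 st tw' tL.
  apply: (wpath_window dP gd dM ballP k0 sP pthP _ tw _ lQ s0 st tw' tL wn).
  by move=> a aw aP; have := lP a aw aP; lra.
(* Of two consecutive letters one is in [P], and its path alone is longer than [l' * k']. *)
- move=> sw; have [a aw aP] : exists2 a, a \in w' & a \in P.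
    case: w' sw rw lw {tw wn lP lQ wl0} => [|a [|b v]] // _ rw _.
    have : alternate P a b by move: rw; rewrite /reduced /= => /andP[_ /andP[]].
    rewrite /alternate; case: (boolP (a \in P)) => aP.
      by exists a => //; rewrite inE eqxx.
    by case: (boolP (b \in P)) => // bP; exists b => //; rewrite !inE eqxx orbT.
  suff : len a <= wlen len w' by have := lP a aw aP; lra.
  elim: w' aw tw {rw wn lw lP lQ wl0 sw} => //= b v IH.
  rewrite inE => /orP[/eqP <-|aw] [bPQ _ tw].
    by have := wlen_ge0 pthP tw; lra.
  by have := IH aw tw; have [? _ _ _ _] := pthP _ bPQ; lra.
Qed.

(** A quasi-geodesic with equal ends has parameter length at most [l' * k'], against the last clause
    of [reduced_path]. A single letter is not [1], which lies in both subgroups. *)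
Lemma reduced_neq1 w : w != [::] -> reduced P Q w -> (\prod_(a <- w) a)%g <> 1%g.
Proof.
move=> wn rw p1; have [A [al [A0 [a0 aA] _ [aq _] sA]]] := reduced_path wn rw.
case: (ltnP 1 (size w)) => sw.
  have := sA sw; have [|||_] := aq 0 A; order_lra.
  by case: dP => dxx _ _; rewrite a0 aA p1 dxx add0r; lra.
case: w wn rw p1 sw {sA aA} => [|a [|? ?]] // _.
by rewrite big_seq1 => /[swap] ->; rewrite /reduced /= /letter !gpred1.
Qed.

Lemma join_cstable : cstable d l' k' M' (joinG P Q).
Proof.
move=> x /join_normal[/andP[xP _]|[w [wn rw <-]]]; last first.
  have [A [al [A0 a0 aJ [aq am] _]]] := reduced_path wn rw.
  by exists A, al; split.
(* An element of the intersection is joined to [1] by its path in [P], which satisfies the local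
   condition at every scale. *)
have [A [al [A0 a0 aP aq am]]] := sP xP.
have [|q' m'] := @local_global 0 A al A0.
  move=> s t s0 st tA _; apply: good_single => //.
    by apply: qgeo_sub aq; lra.
  by apply: cmorse_sub am; lra.
exists A, al; split => // t t0 tA; exact: join_memP (aP _ t0 tA).
Qed.

End Combination.

(** * The word metric *)

Section WordMetric.
Context {R : realType} {G : groupType} (S : finGenSet G).

Notation wl := (word_length S).

Lemma word_lengthP x : exists w, [/\ is_word (mem (gens S)) w, size w = wl x &
  (\prod_(s <- w) s)%g = x].
Proof.
by rewrite /word_length; case: ex_minnP => n /asboolP[w [? <- ?]] _; exists w.
Qed.

Lemma word_length_le w : is_word (mem (gens S)) w ->
  (wl (\prod_(s <- w) s)%g <= size w)%N.
Proof.
move=> ww; rewrite /word_length; case: ex_minnP => n _; apply.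
by apply/asboolP; exists w.
Qed.

Lemma word_length1 : wl 1%g = 0%N.
Proof. by apply/eqP; rewrite -leqn0; have := @word_length_le [::] isT; rewrite big_nil. Qed.

Lemma word_lengthM x y : (wl (x * y)%g <= wl x + wl y)%N.
Proof.
have [u [uu su ux]] := word_lengthP x; have [v [vv sv vy]] := word_lengthP y.
rewrite -su -sv -size_cat -ux -vy -big_cat /=; apply: word_length_le.
by rewrite /is_word all_cat; apply/andP.
Qed.

Lemma word_lengthV x : wl x^-1%g = wl x.
Proof.
suff H y : (wl y^-1%g <= wl y)%N.
  by apply/eqP; rewrite eqn_leq H; have := H x^-1%g; rewrite invgK.
have [u [uu su uy]] := word_lengthP y.
rewrite -su -{1}uy Defs.prodgV -[X in (_ <= X)%N](size_map (fun s => s^-1)%g) -size_rev.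
by apply: word_length_le; exact: is_wordV.
Qed.

Definition word_dist (x y : G) : R := (wl (x^-1 * y)%g)%:R.

Lemma word_dist_pseudometric : is_pseudometric word_dist.
Proof.
split=> [x|x y|x y z]; rewrite /word_dist.
- by rewrite mulVg word_length1.
- by rewrite -word_lengthV invgM invgK.
- rewrite -natrD ler_nat; apply: leq_trans (word_lengthM _ _).
  by rewrite mulgA mulgK.
Qed.

Lemma word_distM g x y : word_dist (g * x)%g (g * y)%g = word_dist x y.
Proof. by rewrite /word_dist invgM -mulgA mulKg. Qed.

Lemma word_dist1 x : word_dist 1%g x = (wl x)%:R.
Proof. by rewrite /word_dist invg1 mul1g. Qed.

Fixpoint word_ball (n : nat) : seq G := if n is m.+1 then
  1%g :: allpairs (fun s x => (s * x)%g) (gens S ++ [seq s^-1%g | s <- gens S]) (word_ball m)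
  else [:: 1%g].

Lemma word_ballP n w : is_word (mem (gens S)) w -> (size w <= n)%N ->
  (\prod_(s <- w) s)%g \in word_ball n.
Proof.
elim: n w => [|n IH] [|s w] //=; rewrite ?big_nil ?inE ?eqxx //.
move=> /andP[sS ww] sw; rewrite big_cons; apply/orP; right.
apply: allpairs_f; last exact: IH.
rewrite mem_cat; case/orP: sS => sS; first by rewrite sS.
by rewrite orbC -[s]invgK map_f.
Qed.

Lemma word_dist_ball (r : R) x : word_dist 1%g x <= r -> x \in word_ball (Num.truncn r).
Proof.
rewrite word_dist1 => xr; have [u [uu su <-]] := word_lengthP x.
apply: word_ballP => //; rewrite su leqNgt truncn_lt_nat ?(le_trans _ xr) //.
by rewrite -leNgt.
Qed.

(** Subwords of a shortest word are shortest: a shorter spelling of the middle piece would shorten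
    the whole. *)
Lemma word_length_take x w i j : is_word (mem (gens S)) w -> size w = wl x ->
  (\prod_(s <- w) s)%g = x -> (i <= j)%N -> (j <= size w)%N ->
  wl ((\prod_(s <- take i w) s)^-1 * \prod_(s <- take j w) s)%g = (j - i)%N.
Proof.
move=> ww sw wx ij jw.
have wd m n : is_word (mem (gens S)) (drop m (take n w)).
  by apply/allP => s /mem_drop/mem_take; move/allP: ww; apply.
have split m n : (m <= n)%N -> (\prod_(s <- take n w) s =
    \prod_(s <- take m w) s * \prod_(s <- drop m (take n w)) s)%g.
  by move=> mn; rewrite -[in RHS](@take_takel _ m n) // -big_cat /= cat_take_drop.
have ub m n : (m <= n)%N -> (n <= size w)%N ->
    (wl ((\prod_(s <- take m w) s)^-1 * \prod_(s <- take n w) s)%g <= n - m)%N.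
  move=> mn nw; rewrite (split m n) // mulKg.
  by apply: leq_trans (word_length_le (wd _ _)) _; rewrite size_drop size_takel.
apply/eqP; rewrite eqn_leq ub //=.
have h1 := ub 0%N i (leq0n _) (leq_trans ij jw).
have h2 := ub j (size w) jw (leqnn _).
rewrite take0 big_nil invg1 mul1g in h1; rewrite take_size wx in h2.
have := word_lengthM (\prod_(s <- take i w) s)%g
  ((\prod_(s <- take i w) s)^-1 * \prod_(s <- take j w) s)%g.
have := word_lengthM (\prod_(s <- take j w) s)%g
  ((\prod_(s <- take j w) s)^-1 * \prod_(s <- w) s)%g.
rewrite !mulVKg wx -sw.
move: h1 h2 ij jw; do 4![move: (wl _) => ?]; lia.
Qed.

Lemma word_dist_geodesic : coarsely_geodesic word_dist.
Proof.
move=> x y; have [w [ww sw wE]] := word_lengthP (x^-1 * y)%g.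
(* Truncating the times changes their difference by less than 1, whence the additive constant 1. *)
exists (fun t => x * \prod_(s <- take (Num.truncn t) w) s)%g.
  rewrite truncn0 take0 big_nil mulg1 /word_dist -sw natrK take_size wE.
  by rewrite mulVKg.
move=> s t s0 st tn; rewrite word_distM /word_dist.
have ts := @le_truncn R s t st.
have tw : (Num.truncn t <= size w)%N by rewrite -(@natrK R (size w)) le_truncn // sw.
rewrite (word_length_take ww sw wE) // natrB //.
have t0 : 0 <= t by lra.
have := truncn_itv s0; have := truncn_itv t0.
rewrite -!natr1; lra.
Qed.

End WordMetric.

Lemma word_length_comparison (G : groupType) (S S' : finGenSet G) :
  exists K : nat, (0 < K)%N /\ forall x, (word_length S x <= K * word_length S' x)%N.
Proof.
pose K := (\max_(s <- gens S') word_length S s).+1; exists K; split => // x.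
have [w [ww <- <-]] := word_lengthP S' x.
elim: w ww => [|s w IH] /=; first by rewrite big_nil word_length1.
move=> /andP[sS ww]; rewrite big_cons mulnS; apply: leq_trans (word_lengthM _ _ _) _.
apply: leq_add; last exact: IH.
have H t : t \in gens S' -> (word_length S t <= K)%N.
  by move=> tS; rewrite /K; apply: leqW; rewrite (big_rem t) //= leq_maxl.
by case/orP: sS => /H //; rewrite word_lengthV.
Qed.

(** * Distances and paths in the Cayley graph *)

Section CayleyDistance.
Context {R : realType} {G : groupType} (S : finGenSet G).
Implicit Types (x y z : cayley R S) (g h : G).

Lemma mdist_pseudometric (X : metricType R) : is_pseudometric (@mdist R X).
Proof.
split; [exact: mdistxx | exact: metric_sym | exact: metric_triangle].
Qed.

Lemma bary_sum (a : G -> R) (s : seq G) g h (t : R) : uniq s -> g \in s -> h \in s ->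
  \sum_(u <- s) bary g h t u * a u = (1 - t) * a g + t * a h.
Proof.
move=> us gs hs; under eq_bigr do rewrite /bary mulrDl.
rewrite big_split /= (bigD1_seq g) //= eqxx (bigD1_seq h (F := fun i => t * _ * _)) //= eqxx.
rewrite !big1 ?addr0 ?mulr1 // => i /negbTE ->; by rewrite mulr0 mul0r.
Qed.

(** Both sides are the sum of [a] weighted by the barycentric coordinates, so the linear extension
    of [a] does not depend on the edge chosen to describe a point. *)
Lemma on_edge_sum (a : G -> R) (f : G -> R) g h t g' h' t' :
  on_edge S f g h t -> on_edge S f g' h' t' ->
  (1 - t) * a g + t * a h = (1 - t') * a g' + t' * a h'.
Proof.
move=> [_ _ fE] [_ _ fE']; pose s := undup [:: g; h; g'; h'].
have us : uniq s by exact: undup_uniq.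
by rewrite -(@bary_sum a s) -?(@bary_sum a s g') // -?fE -?fE' // mem_undup !inE eqxx ?orbT.
Qed.

(** The linear extension of [a] varies along each segment of a chain by at most the length of the
    segment. *)
Lemma chain_lipschitz (a : G -> R) x y l :
  (forall g h, adjacent_or_eq S g h -> `|a g - a h| <= 1) -> chain x y l ->
  forall g h t g' h' t', on_edge S (Defs.coord x) g h t -> on_edge S (Defs.coord y) g' h' t' ->
  `|((1 - t) * a g + t * a h) - ((1 - t') * a g' + t' * a h')| <= l.
Proof.
move=> alip; elim=> [{}x g h t g' h' t' e e'|{}x {}y z g0 h0 t0 s0 {}l e0 e1 _ IH g h t g'
    h' t' e e'].
  by rewrite (on_edge_sum a e e') subrr normr0.
rewrite (on_edge_sum a e e0).
apply: le_trans (ler_distD ((1 - s0) * a g0 + s0 * a h0) _ _) _.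
apply: lerD; last exact: IH.
have -> : (1 - t0) * a g0 + t0 * a h0 - ((1 - s0) * a g0 + s0 * a h0) =
  (t0 - s0) * (a h0 - a g0) by ring.
rewrite normrM ler_piMr // distrC; apply: alip; by case: e0.
Qed.

Lemma adjacent_length g h : adjacent_or_eq S g h -> (word_length S (g^-1 * h)%g <= 1)%N.
Proof.
case/or3P => [/eqP->|gh|hg]; first by rewrite mulVg word_length1.
  have := @word_length_le _ S [:: (g^-1 * h)%g]; rewrite big_seq1; apply.
  by rewrite /is_word /= gh.
have := @word_length_le _ S [:: (g^-1 * h)%g]; rewrite big_seq1; apply.
by rewrite /is_word /= invgM invgK hg orbT.
Qed.

Lemma vertex_edge g : on_edge S (Defs.coord (vertex R S g)) g g 0.
Proof. by split; rewrite ?lexx ?ler01 // /adjacent_or_eq eqxx. Qed.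

Lemma chain_geodesic g h : chain (vertex R S g) (vertex R S h) (word_dist S g h).
Proof.
have [w [ww sw wE]] := word_lengthP S (g^-1 * h)%g.
have := @chain_word R G S w g ww; rewrite wE mulVKg; by rewrite /word_dist -sw.
Qed.

(** A shortest word is a chain of the right length; for the lower bound [chain_lipschitz] is applied
    to the word distance from [g]. *)
Lemma mdist_vertex g h : mdist (vertex R S g) (vertex R S h) = word_dist S g h.
Proof.
apply/eqP; rewrite eq_le; apply/andP; split.
  exact: (cayley_dist_le (chain_geodesic g h)).
apply: cayley_dist_ge => l gh.
have [] := @word_dist_pseudometric R G S.
pose a u : R := word_dist S g u.
move=> dxx dC dD; have alip u v : adjacent_or_eq S u v -> `|a u - a v| <= 1.
  move=> uv; have uv1 : word_dist S u v <= 1 :> R.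
    by rewrite /word_dist -[leRHS]/(1%:R) ler_nat; exact: adjacent_length.
  rewrite ler_norml; apply/andP; split; rewrite /a.
    have := dD g u v; lra.
  by have := dD g v u; rewrite (dC v u); lra.
have := chain_lipschitz alip gh (vertex_edge g) (vertex_edge h).
rewrite !subr0 !mul0r !addr0 !mul1r /a dxx sub0r normrN.
by apply: le_trans; exact: ler_norm.
Qed.

Lemma vertex_inj : injective (vertex R S).
Proof.
move=> g h gh; have := mdist_vertex g h; rewrite gh mdistxx /word_dist => /esym/eqP.
rewrite pnatr_eq0; have [w [_ <- wE]] := word_lengthP S (g^-1 * h)%g.
move=> /nilP w0; move: wE; rewrite w0 big_nil => /(congr1 (fun x : G => g * x)%g).
by rewrite mulg1 mulVKg.
Qed.

Lemma near_vertex x : exists g, mdist x (vertex R S g) <= 1.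
Proof.
have [g [h [t xt]]] := coord_on_edge x; exists g.
have gt : on_edge S (Defs.coord (vertex R S g)) g h 0.
  by case: xt => gh _ _; split; rewrite ?lexx ?ler01 //= bary0.
apply: le_trans (cayley_dist_le (chain_seg xt gt)) _.
by case: xt => _ /andP[t0 t1] _; rewrite subr0 ger0_norm.
Qed.

End CayleyDistance.

(** * Lipschitz paths, as a source of continuous paths *)

Section LipschitzPaths.
Import numFieldNormedType.Exports.
Context {R : realType} {X : metricType R}.
Implicit Types (f g : R -> X).

Definition lip_on (K a b : R) f := forall s t, a <= s -> s <= t -> t <= b ->
  mdist (f s) (f t) <= K * (t - s).

Definition path_cat (m : R) f g (u : R) : X := if u <= m then f u else g u.

Lemma path_catl m f g u : u <= m -> path_cat m f g u = f u.
Proof. by rewrite /path_cat => ->. Qed.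

Lemma path_catr m f g u : f m = g m -> m <= u -> path_cat m f g u = g u.
Proof.
move=> fg; rewrite /path_cat le_eqVlt => /orP[/eqP<-|]; first by rewrite lexx.
by rewrite leNgt => ->.
Qed.

Lemma lipschitz_cat K a m b f g : f m = g m -> a <= m -> m <= b ->
  lip_on K a m f -> lip_on K m b g -> lip_on K a b (path_cat m f g).
Proof.
move=> fg am mb Hf Hg s t as_ st tb.
case: (leP t m) => tm.
  by rewrite !path_catl //; [exact: Hf|lra].
rewrite (path_catr fg (ltW tm)); case: (leP s m) => sm.
  rewrite path_catl //; apply: le_trans (metric_triangle _ (f m) _) _.
  have h1 := Hf s m as_ sm (lexx m); have h2 := Hg m t (lexx m) (ltW tm) tb.
  rewrite -fg in h2; have -> : K * (t - s) = K * (m - s) + K * (t - m) by ring.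
  exact: lerD.
by rewrite (path_catr fg (ltW sm)) //; apply: Hg => //; lra.
Qed.

Lemma lipschitz_weaken K K' a b f : K <= K' -> lip_on K a b f ->
  lip_on K' a b f.
Proof.
move=> KK H s t ? ? ?; apply: le_trans (H s t _ _ _) _ => //.
by apply: ler_wpM2r => //; lra.
Qed.

Lemma lipschitz_shift K a b c f : lip_on K (a - c) (b - c) f ->
  lip_on K a b (fun t => f (t - c)).
Proof.
move=> H s t ? ? ?; have -> : t - s = t - c - (s - c) by lra.
by apply: H; lra.
Qed.

Lemma lipschitz_continuous K a b f : lip_on K a b f ->
  {within `[a, b], continuous f}.
Proof.
move=> H; apply/subspace_continuousP => x; rewrite /= in_itv /= => /andP[ax xb].
have Kp : 0 < `|K| + 1 by rewrite ltr_wpDl.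
apply/cvg_ballP => e e0; near=> y.
rewrite ballEmdist /=.
have : `[a, b]%classic y by near: y; exact: withinT.
rewrite /= in_itv /= => /andP[ay yb].
have xy : `|x - y| < e / (`|K| + 1).
  by near: y; apply: cvg_within; exact: (@nbhsx_ballx _ R x _ (divr_gt0 e0 Kp)).
have Kxy : (`|K| + 1) * `|x - y| < e by rewrite mulrC -ltr_pdivlMr.
apply: le_lt_trans Kxy.
have KK : K <= `|K| + 1 by rewrite (le_trans (ler_norm K)) // lerDl.
have H' := lipschitz_weaken KK H.
case: (leP x y) => xly.
  by rewrite distrC (@ger0_norm _ (y - x)) ?subr_ge0 //; apply: H'.
by rewrite (@gtr0_norm _ (x - y)) ?subr_gt0 // metric_sym; apply: H' => //; exact: ltW.
Unshelve. all: by end_near.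
Qed.

Lemma lipschitz_path K a b f : lip_on K a b f -> is_path `[a, b] f.
Proof.
move=> H; split; [exact: interval_is_interval|exact: itv_closed_ends_closed|].
exact: lipschitz_continuous H.
Qed.

Lemma quasi_geodesicE l k a b f : 0 < l -> is_path `[a, b] f ->
  quasi_geodesic l k `[a, b] f <-> qgeo mdist l k a b f.
Proof.
move=> l0 pf; split=> [[_ H] s t as_ st tb|H]; last first.
  split => // s t; rewrite /= !in_itv /= => /andP[as_ sb] /andP[at_ tb].
  wlog st : s t as_ sb at_ tb / s <= t.
    move=> W; case: (leP s t) => st; first exact: W.
    by rewrite distrC metric_sym; apply: W => //; exact: ltW.
  have [|||U L] := H s t; try lra.
  rewrite ler0_norm ?subr_le0 // opprB U andbT.
  by rewrite lerBlDr mulrC ler_pdivrMr // mulrC.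
have := H s t; rewrite /= !in_itv /= => /(_ _ _)/andP[||].
- by apply/andP; split => //; lra.
- by apply/andP; split => //; lra.
rewrite ler0_norm ?subr_le0 // opprB => L U; split => //.
by move: L; rewrite lerBlDr mulrC ler_pdivrMr // mulrC.
Qed.

End LipschitzPaths.

(** * Coarse paths in the Cayley graph *)

Lemma cmorse_close (R : realType) (T : Type) (d : T -> T -> R) M a b f g D :
  is_pseudometric d -> 0 <= D -> (forall t, a <= t -> t <= b -> d (f t) (g t) <= D) ->
  cmorse d M a b f ->
  cmorse d (fun Q q => Num.max 0 (M Q (q + 2 * D)) + 2 * D) a b g.
Proof.
move=> dP D0 fg Mf Q q s t a' b' eta Q1 q0 as_ st tb ab Hq es et u au ub.
have [_ dC dD] := dP.
have [||v vst Hv] := cmorse_near dP D0 Mf Q1 q0 as_ st tb ab Hq _ _ au ub.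
- by rewrite es dC; apply: fg; lra.
- by rewrite et dC; apply: fg; lra.
exists v => //; have := dD (eta u) (f v) (g v).
have : d (f v) (g v) <= D by apply: fg; lra.
by move: (Num.max 0 _) Hv => ? *; lra.
Qed.

Section CayleyPaths.
Context {R : realType} {G : groupType} (S : finGenSet G).
Notation X := (cayley R S).
Notation dX := (@mdist R X).
Notation dG := (@word_dist R G S).
Notation vtx := (vertex R S).
Implicit Types (x y z : X) (M : R -> R -> R).

Let XP : is_pseudometric dX. Proof. exact: mdist_pseudometric. Qed.
Let GP : is_pseudometric dG. Proof. exact: word_dist_pseudometric. Qed.

Lemma edge_path x y g h t s : on_edge S (Defs.coord x) g h t ->
  on_edge S (Defs.coord y) g h s -> exists f : R -> X,
  [/\ f 0 = x, f `|t - s| = y & lip_on 1 0 `|t - s| f].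
Proof.
move=> [gh t01 xt] [_ s01 ys].
have /choice[pt ptP] : forall r, exists z : X, 0 <= r <= 1 -> on_edge S (Defs.coord z) g h r.
  move=> r; have [r01|_] := boolP (0 <= r <= 1); last by exists x.
  have e : on_edge S (bary g h r) g h r by [].
  by exists (Cayley (ex_intro _ g (ex_intro _ h (ex_intro _ r e)))).
have ptt : pt t = x by apply: coord_inj; rewrite xt; case: (ptP t t01).
have pts : pt s = y by apply: coord_inj; rewrite ys; case: (ptP s s01).
have ptd r r' : 0 <= r <= 1 -> 0 <= r' <= 1 -> dX (pt r) (pt r') <= `|r - r'|.
  by move=> /ptP e /ptP e'; exact: (cayley_dist_le (chain_seg e e')).
case: (leP t s) => ts.
  exists (fun u => pt (t + u)); rewrite distrC ger0_norm ?subr_ge0 //; split.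
  - by rewrite addr0.
  - by rewrite addrC subrK.
  move=> u v u0 uv vs; rewrite mul1r; apply: le_trans (ptd _ _ _ _) _; try lra.
  by rewrite distrC ger0_norm; lra.
exists (fun u => pt (t - u)); rewrite gtr0_norm ?subr_gt0 //; split.
- by rewrite subr0.
- by rewrite subKr.
move=> u v u0 uv vs; rewrite mul1r; apply: le_trans (ptd _ _ _ _) _; try lra.
by rewrite ger0_norm; lra.
Qed.

Lemma chain_path x y l : chain x y l -> exists f : R -> X,
  [/\ f 0 = x, f l = y & lip_on 1 0 l f].
Proof.
elim=> [{}x|{}x {}y z g h t s {}l xt ys yz [f [f0 fl fL]]].
  exists (fun=> x); split => // s t ? ? ?; rewrite mdistxx; lra.
have [e [e0 e1 eL]] := edge_path xt ys; set m := `|t - s| in e1 eL *.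
have m0 : 0 <= m by exact: normr_ge0.
have l0 := chain_ge0 yz.
have j : e m = f (m - m) by rewrite subrr f0.
exists (path_cat m e (fun u => f (u - m))); split.
- by rewrite path_catl.
- by rewrite path_catr ?lerDl // addrC addKr.
- apply: lipschitz_cat => //; first by rewrite lerDl.
  by apply: lipschitz_shift; rewrite subrr addrC addKr.
Qed.

(** The distance is an infimum of lengths of chains, hence the slack 1. The constant [K] depends on
    the length of the interval and serves to give continuity. *)
Lemma length_path x y a b : a < b -> exists (K : R) (f : R -> X),
  [/\ 0 <= K, f a = x, f b = y, lip_on K a b f &
    forall t, a <= t -> t <= b -> dX x (f t) <= dX x y + 1].
Proof.
move=> ab; have ab0 : 0 < b - a by rewrite subr_gt0.
have hI : has_inf [set l | chain x y l].
  by split; [exact: chain_connected|exists 0 => l; exact: chain_ge0].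
have [l xyl] := inf_adherent (@ltr01 R) hI; rewrite -/(dX x y) => ll.
have [f [f0 fl fL]] := chain_path xyl; have l0 := chain_ge0 xyl.
have c0 : 0 <= l / (b - a) by apply: divr_ge0 => //; exact: ltW.
have sc t : a <= t -> t <= b -> 0 <= l / (b - a) * (t - a) <= l.
  move=> at_ tb; rewrite mulr_ge0 ?subr_ge0 //= mulrAC ler_pdivrMr //.
  by apply: ler_wpM2l => //; lra.
exists (l / (b - a)), (fun t => f (l / (b - a) * (t - a))); split => //.
- by rewrite subrr mulr0.
- by rewrite divfK ?gt_eqF.
- move=> s t as_ st tb; have /andP[s0 _] := sc s as_ (le_trans st tb).
  have /andP[_ tl] := sc t (le_trans as_ st) tb.
  have -> : l / (b - a) * (t - s) = 1 * (l / (b - a) * (t - a) - l / (b - a) * (s - a)).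
    by ring.
  by apply: fL => //; apply: ler_wpM2l => //; lra.
- move=> t at_ tb; have /andP[t0 tl] := sc t at_ tb.
  have := fL 0 _ (lexx 0) t0 tl; rewrite f0 subr0 mul1r.
  move=> h1; apply: le_trans h1 _; apply: le_trans tl _; exact: ltW.
Qed.

(** On each interval of length at most 1 the values of [F] at the ends are joined by an almost
    shortest path. It stays within [D + 1] of [F] at the left end, which is within [D] of [F t]. *)
Lemma tame (F : R -> X) D a b : a <= b ->
  (forall s t, a <= s -> s <= t -> t <= b -> t - s <= 1 -> dX (F s) (F t) <= D) ->
  exists (K : R) (f : R -> X), [/\ 0 <= K, lip_on K a b f, f a = F a, f b = F b &
    forall t, a <= t -> t <= b -> dX (f t) (F t) <= 2 * D + 1].
Proof.
move=> ab HD.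
have D0 : 0 <= D by have := HD a a (lexx a) (lexx a) ab; rewrite subrr mdistxx; apply; lra.
have [_ dC dD] := XP.
have piece a' b' : a <= a' -> a' < b' -> b' <= b -> b' - a' <= 1 ->
    exists (K : R) (f : R -> X), [/\ 0 <= K, lip_on K a' b' f, f a' = F a', f b' = F b' &
    forall t, a' <= t -> t <= b' -> dX (f t) (F t) <= 2 * D + 1].
  move=> aa ab' bb b1; have [K [f [K0 fa fb fL fd]]] := length_path (F a') (F b') ab'.
  exists K, f; split => // t at_ tb; have := fd t at_ tb; have := dD (f t) (F a') (F t).
  have h1 : dX (F a') (F b') <= D by apply: HD; lra.
  have h2 : dX (F a') (F t) <= D by apply: HD; lra.
  by rewrite (dC (f t) (F a')); lra.
have [n] : exists n : nat, b - a <= n%:R.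
  by exists (Num.truncn (b - a)).+1; apply/ltW; rewrite truncnS_gt.
suff H b' : a <= b' -> b' <= b -> b' - a <= n%:R -> exists (K : R) (f : R -> X),
    [/\ 0 <= K, lip_on K a b' f, f a = F a, f b' = F b' &
    forall t, a <= t -> t <= b' -> dX (f t) (F t) <= 2 * D + 1] by move=> nb; exact: H.
elim: n b' => [|n IH] b' ab' b'b ban; rewrite -?natr1 in ban.
  exists 0, F; have E : b' = a by lra.
  split => //; first by move=> s t ? ? ?; (have -> : s = t by lra); rewrite mdistxx; lra.
  by move=> t ? ?; rewrite mdistxx; lra.
move: ab'; rewrite le_eqVlt => /orP[/eqP E|ab'].
  exists 0, F; split => //; first by move=> s t ? ? ?; (have -> : s = t by lra); rewrite
      mdistxx; lra.
  by move=> t ? ?; rewrite mdistxx; lra.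
case: (leP (b' - a) 1) => b1.
  by apply: piece => //; lra.
have [|||K1 [f1 [K10 L1 f1a f1b d1]]] := IH (b' - 1); try lra.
have [||||K2 [f2 [K20 L2 f2a f2b d2]]] := piece (b' - 1) b'; try lra.
have j : f1 (b' - 1) = f2 (b' - 1) by rewrite f1b f2a.
exists (Num.max K1 K2), (path_cat (b' - 1) f1 f2); split.
- by rewrite le_max K10.
- apply: lipschitz_cat => //; try lra.
    by apply: lipschitz_weaken L1; rewrite le_max lexx.
  by apply: lipschitz_weaken L2; rewrite le_max lexx orbT.
- by rewrite path_catl //; lra.
- by rewrite path_catr //; lra.
move=> t at_ tb; case: (leP t (b' - 1)) => tb1.
  by rewrite path_catl //; exact: d1.
by rewrite path_catr ?(ltW tb1) //; apply: d2 => //; exact: ltW.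
Qed.

(** The bound of [tame] for a quasi-geodesic, which moves by at most [Q + q] in unit time. *)
Definition tame_const (Q q : R) : R := 2 * (Q + q) + 1.

Lemma tame_qgeo (F : R -> X) Q q a b : 0 < Q -> 0 <= q -> a <= b ->
  qgeo dX Q q a b F -> exists f : R -> X,
  [/\ is_path `[a, b] f, f a = F a, f b = F b,
    (forall t, a <= t -> t <= b -> dX (f t) (F t) <= tame_const Q q) &
    quasi_geodesic Q (q + 2 * tame_const Q q) `[a, b] f].
Proof.
move=> Q0 q0 ab HF; have [_ dC _] := XP.
have [|K [f [K0 fL fa fb fd]]] := @tame F (Q + q) a b ab.
  move=> s t as_ st tb ts; have [|||U _] := HF s t => //.
  have : Q * (t - s) <= Q by rewrite ler_piMr // ltW.
  lra.
have fp := lipschitz_path fL; exists f; split => //.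
apply/(quasi_geodesicE _ Q0 fp); apply: (qgeo_near XP (ltW Q0) _ HF).
by move=> t ? ?; rewrite dC; exact: fd.
Qed.

(** A coarse competitor is replaced by a nearby continuous one with the same ends, to which the
    Morse property applies. *)
Lemma morse_cmorse (M : morseGauge R) a b (g : R -> X) : morse M `[a, b] g ->
  cmorse dX (fun Q q => M Q (q + 2 * tame_const Q q) + tame_const Q q) a b g.
Proof.
move=> Mg Q q s t a' b' eta Q1 q0 as_ st tb ab Hq es et u au ub.
have [|f [fp fa fb fd fq]] := @tame_qgeo eta Q q a' b' _ q0 ab Hq; try lra.
have c0 : 0 <= tame_const Q q by rewrite /tame_const; lra.
have [_ dC dD] := XP.
have [||||||_ [v vst <-] Hv] := Mg Q (q + 2 * tame_const Q q) s t a' b' f Q1 _ _ _ st ab fq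
    _ _ (f u).
- by lra.
- by rewrite /= in_itv /=; apply/andP; lra.
- by rewrite /= in_itv /=; apply/andP; lra.
- by rewrite fa.
- by rewrite fb.
- by exists u => //; rewrite /= in_itv /=; apply/andP; lra.
exists v; first by move: vst; rewrite /= in_itv.
have := dD (eta u) (f u) (g v); have := fd u au ub; rewrite dC; lra.
Qed.

Lemma cmorse_morse M (M' : morseGauge R) a b (g : R -> X) :
  (forall Q q, 1 <= Q -> 0 <= q -> M Q q <= M' Q q) ->
  cmorse dX M a b g -> morse M' `[a, b] g.
Proof.
move=> MM Mg Q q s t a' b' eta Q1 q0.
rewrite /= !in_itv /= => /andP[as_ sb] /andP[at_ tb] st ab Hq es et _ [u + <-].
rewrite /= in_itv /= => /andP[au ub].
have Q0 : 0 < Q by lra.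
have Hq' : qgeo dX Q q a' b' eta by apply/quasi_geodesicE => //; case: Hq.
have [v vst Hv] := Mg Q q s t a' b' eta Q1 q0 as_ st tb ab Hq' es et u au ub.
exists (g v); last by apply: le_trans Hv _; exact: MM.
by exists v => //; rewrite /= in_itv.
Qed.

Lemma qgeo_vertex l k a b (f : R -> G) :
  qgeo dX l k a b (fun t => vtx (f t)) <-> qgeo dG l k a b f.
Proof. by split=> H s t ? ? ?; have := H s t; rewrite mdist_vertex; apply. Qed.

Lemma cmorse_of_vertex M a b (f : R -> G) :
  cmorse dX M a b (fun t => vtx (f t)) -> cmorse dG M a b f.
Proof.
move=> H Q q s t a' b' eta Q1 q0 as_ st tb ab Hq es et u au ub.
have [|||v vst Hv] := H Q q s t a' b' (fun u => vtx (eta u)) Q1 q0 as_ st tb ab _ _ _ u au ub.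
- exact/qgeo_vertex.
- by rewrite es.
- by rewrite et.
by exists v => //; rewrite -mdist_vertex.
Qed.

(** A competitor in the graph is rounded to vertices. In [q + 4], one 2 comes from rounding and the
    other from moving the ends; the final 2 is made of the same two errors. *)
Lemma cmorse_vertex M a b (f : R -> G) : cmorse dG M a b f ->
  cmorse dX (fun Q q => Num.max 0 (M Q (q + 4)) + 2) a b (fun t => vtx (f t)).
Proof.
move=> H Q q s t a' b' eta Q1 q0 as_ st tb ab Hq es et u au ub.
have [_ dC dD] := XP.
have /choice[r rP] : forall u, exists g, dX (eta u) (vtx g) <= 1.
  by move=> w; exact: near_vertex.
have Hr : qgeo dG Q (q + 2 * 1) a' b' r.
  apply/qgeo_vertex; apply: (qgeo_near XP _ _ Hq) => //; lra.
have [|||v vst Hv] := cmorse_near GP (@ler01 R) H Q1 _ as_ st tb ab Hr _ _ au ub.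
- by lra.
- by rewrite -mdist_vertex -es dC.
- by rewrite -mdist_vertex -et dC.
exists v => //; have := dD (eta u) (vtx (r u)) (vtx (f v)).
rewrite mdist_vertex; have := rP u.
have E : q + 2 * 1 + 2 * 1 = q + 4 by lra.
by rewrite E in Hv; move: (Num.max 0 _) Hv => ? *; lra.
Qed.

End CayleyPaths.

(** * From the Cayley graph to the word metric and back *)

Definition coarse_local_to_global (R : realType) (T : Type) (d : T -> T -> R) :=
  forall (l k : R) (M : R -> R -> R), 1 <= l -> 0 <= k ->
  exists (L l' k' : R) (M' : R -> R -> R), [/\ 0 < L, 1 <= l', 0 <= k' &
    forall (a b : R) (f : R -> T), a <= b ->
      (forall s t, a <= s -> s <= t -> t <= b -> t - s <= L ->
         qgeo d l k s t f /\ cmorse d M s t f) ->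
      qgeo d l' k' a b f /\ cmorse d M' a b f].

Section ChangeOfMetric.
Context {R : realType} {T : Type} (d d' : T -> T -> R) (K : R).
Hypotheses (K1 : 1 <= K) (dd' : forall x y, d x y <= K * d' x y)
  (d'd : forall x y, d' x y <= K * d x y).

Lemma qgeo_comparable l k a b (f : R -> T) : 1 <= l -> 0 <= k ->
  qgeo d l k a b f -> qgeo d' (K * l) (K * k) a b f.
Proof.
move: K1 => K1' l1 k0 H s t as_ st tb; have [|||U L] := H s t => //.
have K0 : 0 <= K by lra.
split.
  apply: le_trans (d'd _ _) _; have := ler_wpM2l K0 U; nra.
apply: le_trans L _; rewrite (mulrC K) -mulrA; apply: ler_wpM2l; first lra.
rewrite mulrDr; apply: lerD; first exact: dd'.
have kK : k <= K * k by rewrite ler_peMl.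
by apply: le_trans kK _; rewrite ler_peMl ?mulr_ge0.
Qed.

End ChangeOfMetric.

Lemma cmorse_comparable (R : realType) (T : Type) (d d' : T -> T -> R) K M a b
    (f : R -> T) : 1 <= K -> (forall x y, d x y <= K * d' x y) ->
  (forall x y, d' x y <= K * d x y) ->
  cmorse d M a b f -> cmorse d' (fun Q q => K * M (K * Q) (K * q)) a b f.
Proof.
move=> K1 dd' d'd H Q q s t a' b' eta Q1 q0 as_ st tb ab Hq es et u au ub.
have KQ : 1 <= K * Q by rewrite mulr_ege1.
have Kq : 0 <= K * q by apply: mulr_ge0; lra.
have Hq' := qgeo_comparable K1 d'd dd' Q1 q0 Hq.
have [v vst Hv] := H (K * Q) (K * q) s t a' b' eta KQ Kq as_ st tb ab Hq' es et u au ub.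
exists v => //; apply: le_trans (d'd _ _) _; apply: ler_wpM2l => //; lra.
Qed.

Lemma local_to_global_comparable (R : realType) (T : Type) (d d' : T -> T -> R) K :
  1 <= K -> (forall x y, d x y <= K * d' x y) -> (forall x y, d' x y <= K * d x y) ->
  coarse_local_to_global d -> coarse_local_to_global d'.
Proof.
move=> K1 dd' d'd LG l k M l1 k0.
have Kl (x : R) : 1 <= x -> 1 <= K * x by move=> ?; rewrite mulr_ege1.
have Kk (x : R) : 0 <= x -> 0 <= K * x by move=> ?; apply: mulr_ge0; lra.
have [L [l' [k' [M' [L0 l'1 k'0 H]]]]] :=
  LG _ _ (fun Q q => K * M (K * Q) (K * q)) (Kl _ l1) (Kk _ k0).
exists L, (K * l'), (K * k'), (fun Q q => K * M' (K * Q) (K * q)).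
split; rewrite ?Kl ?Kk // => a b f ab loc.
have [|q m] := H a b f ab.
  move=> s t as_ st tb ts; have [q m] := loc s t as_ st tb ts.
  by split; [exact: (qgeo_comparable K1 d'd dd')|exact: cmorse_comparable].
by split; [exact: (qgeo_comparable K1 dd' d'd)|exact: cmorse_comparable].
Qed.

Section Coarsening.
Context {R : realType} {G : groupType} (S : finGenSet G).
Notation X := (cayley R S).
Notation dX := (@mdist R X).
Notation dG := (@word_dist R G S).
Notation vtx := (vertex R S).

Let XP : is_pseudometric dX. Proof. exact: mdist_pseudometric. Qed.

(** The coarse path [f] is replaced by a continuous [g] within distance [c]. Local properties pass
    from [f] to [g], become global there, and return to [f], with loss [2 * c] in the additive
    constant each time. *)
Lemma MLTG_coarse : MLTG (cayley R S) -> coarse_local_to_global dG.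
Proof.
move=> H l k M l1 k0; have [_ dC dD] := XP.
set c := 2 * (l + k) + 1; have c0 : 0 <= c by rewrite /c; lra.
pose M1 Q q := Num.max 0 (Num.max 0 (M Q (q + 2 * c + 4)) + 2) + 2 * c.
have M10 Q q : 1 <= Q -> 0 <= q -> 0 <= M1 Q q.
  by move=> _ _; rewrite addr_ge0 ?le_max ?lexx //; lra.
have k2 : 0 <= k + 2 * c by lra.
have [L [l' [k' [N [L0 l'1 k'0 loc]]]]] := H l (k + 2 * c) (MorseGauge M10) l1 k2.
pose N1 Q q := N Q (q + 2 * tame_const Q q) + tame_const Q q.
(* The scale is at least 1 because [tame] needs control of [f] over unit time. *)
exists (Num.max L 1), l', (k' + 2 * c), (fun Q q => Num.max 0 (N1 Q (q + 2 * c)) + 2 * c).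
split; rewrite ?lt_max ?L0 //; first lra.
move=> a b f ab wf.
have [|K [g [K0 gL ga gb gd]]] := @tame R G S (fun t => vtx (f t)) (l + k) a b ab.
  move=> s t as_ st tb ts; have [|q _] := wf s t as_ st tb.
    by rewrite le_max ts orbT.
  have [|||U _] := q s t => //; rewrite mdist_vertex; apply: le_trans U _.
  have : l * (t - s) <= l by rewrite ler_piMr //; lra.
  lra.
rewrite -/c in gd.
have gp s t : a <= s -> t <= b -> is_path `[s, t] g.
  move=> as_ tb; apply: (@lipschitz_path _ _ K).
  by move=> u v ? ? ?; apply: gL; lra.
have [|gq gm] := loc `[a, b]%classic g (gp _ _ (lexx _) (lexx _)).
  move=> s t st ts sub.
  have /andP[as_ _] : a <= s <= b.
    by have := sub s; rewrite /= !in_itv /=; apply; rewrite lexx st.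
  have /andP[_ tb] : a <= t <= b.
    by have := sub t; rewrite /= !in_itv /=; apply; rewrite lexx st.
  have [|q m] := wf s t as_ st tb; first by rewrite le_max ts.
  have close u : s <= u -> u <= t -> dX (vtx (f u)) (g u) <= c.
    by move=> ? ?; rewrite dC; apply: gd; lra.
  split.
    apply/quasi_geodesicE; [lra|exact: gp|].
    apply: (qgeo_near XP _ close); first lra.
    exact/qgeo_vertex.
  apply: cmorse_morse (cmorse_close XP c0 close (cmorse_vertex m)).
  by move=> Q q' _ _; rewrite /= /M1.
have close u : a <= u -> u <= b -> dX (g u) (vtx (f u)) <= c by exact: gd.
split.
  apply/qgeo_vertex; apply: (qgeo_near XP _ close); first lra.
  by apply/quasi_geodesicE; [lra|exact: gp|].
exact: cmorse_of_vertex (cmorse_close XP c0 close (morse_cmorse gm)).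
Qed.

(** Points of the Morse geodesic are moved by at most [r] into [P], which accounts for the additive
    constant [2 * r]. *)
Lemma stable_coarse (M : morseGauge R) (r : R) (P : groupClosed G) : 0 <= r ->
  stable_with S M r P ->
  cstable dG 1 (2 * r) (fun Q q => let q' := q + 2 * r in
    Num.max 0 (M Q (q' + 2 * tame_const Q q') + tame_const Q q') + 2 * r) P.
Proof.
move=> r0 sP x xP; have [_ dC dD] := XP.
have [a [b [g [ab [gp gd] [ga gb] gm gN]]]] := sP 1%g x (@gpred1 _ P) xP.
(* The two ends are prescribed exactly; if they coincide, [x] is [1] because vertices of distinct
   elements are distinct. *)
have /choice[f fP] : forall t, exists y, a <= t <= b ->
    [/\ y \in P, dX (g t) (vtx y) <= r, t = a -> y = 1%g & t = b -> y = x].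
  move=> t; have [tab|_] := boolP (a <= t <= b); last by exists 1%g.
  have [tb|tb] := eqVneq t b.
    exists x => _; split => //; first by rewrite tb gb mdistxx.
    by move=> ta; apply: (@vertex_inj R G S); rewrite -gb -ga -ta -tb.
  have [ta|ta] := eqVneq t a.
    exists 1%g => _; split; [exact: gpred1| |by []|by move=> E; rewrite E eqxx in tb].
    by rewrite ta ga mdistxx.
  have [_ [y yP <-] gy] : closed_nbhd (vtx @` [set` P]) r (g t).
    by apply: gN; exists t => //; rewrite /= in_itv.
  by exists y => _; split => // E; [move: ta|move: tb]; rewrite E eqxx.
have close t : a <= t -> t <= b -> dX (g t) (vtx (f t)) <= r.
  by move=> at_ tb; have [] := fP t; rewrite ?at_ ?tb.
have gq : qgeo dX 1 0 a b g.
  move=> s t as_ st tb; have -> : dX (g s) (g t) = t - s.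
    rewrite gd; first by rewrite distrC ger0_norm ?subr_ge0.
    - by rewrite /= in_itv /=; apply/andP; lra.
    - by rewrite /= in_itv /=; apply/andP; lra.
  lra.
exists (b - a), (fun t => f (t - - a)).
have E0 : 0 - - a = a by lra.
have Eb : b - a - - a = b by lra.
split; first lra.
- rewrite E0 Eb; have [|_ _ + _] := fP a; first by rewrite lexx ab.
  by have [|_ _ _ +] := fP b; rewrite ?lexx ?ab // => -> // ->.
- by move=> t t0 tb; have [|? _ _ _] := fP (t - - a) => //; lra.
- apply: qgeo_shift; rewrite E0 Eb -[2 * r]add0r.
  by apply/qgeo_vertex; apply: (qgeo_near XP _ close gq).
- apply: cmorse_shift; rewrite E0 Eb.
  exact: cmorse_of_vertex (cmorse_close XP r0 close (morse_cmorse gm)).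
Qed.

(** Stability asks for a genuine geodesic with the ends of the coarse path [al]. It inherits the
    Morse property by [morse_transfer], and it stays near [J] because it is itself a competitor of
    [al] with constants 1 and 0. *)
Lemma coarse_stable l k M (J : groupClosed G) : 1 <= l -> 0 <= k ->
  cstable dG l k M J -> stable R S J.
Proof.
move=> l1 k0 sJ; have [_ dC dD] := XP.
pose M1 Q q := Num.max 0 (M Q (q + 4)) + 2.
pose M2 Q q := Num.max 0 (transfer_gauge M1 l k 1 0 0 Q q).
have M20 Q q : 1 <= Q -> 0 <= q -> 0 <= M2 Q q by rewrite le_max lexx.
have M110 : 0 <= M1 1 0 by rewrite addr_ge0 ?le_max ?lexx.
exists (MorseGauge M20), (M1 1 0); split => // x y xJ yJ.
have [A [al [A0 [a0 aA] aJ aq am]]] := cstable_path (@word_distM R G S) sJ xJ yJ.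
have [g [g0 gn gL]] := chain_path (@chain_geodesic R G S x y).
set n := word_dist S x y in gn gL *.
have n0 : 0 <= n by rewrite /n /word_dist.
(* A 1-Lipschitz path whose length equals the distance of its ends is geodesic. *)
have gd s t : 0 <= s -> s <= t -> t <= n -> dX (g s) (g t) = t - s.
  move=> s0 st tn; apply/eqP; rewrite eq_le; apply/andP; split.
    by have := gL s t s0 st tn; rewrite mul1r.
  have h1 := gL 0 s (lexx _) s0 (le_trans st tn).
  have h2 := gL t n (le_trans s0 st) tn (lexx _).
  have h3 : dX (g 0) (g n) = n by rewrite g0 gn mdist_vertex.
  have := dD (g 0) (g s) (g n); have := dD (g s) (g t) (g n); lra.
have gq : qgeo dX 1 0 0 n g.
  by move=> s t s0 st tn; rewrite gd //; lra.
have vq : qgeo dX l k 0 A (fun t => vtx (al t)) by exact/qgeo_vertex.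
have vm := cmorse_vertex am; rewrite -/M1 in vm.
exists 0, n, g; split => //.
- split; first exact: lipschitz_path gL.
  move=> s t; rewrite /= !in_itv /= => /andP[s0 sn] /andP[t0 tn].
  case: (leP s t) => st; first by rewrite gd // distrC ger0_norm ?subr_ge0.
  by rewrite dC gd ?(ltW st) // gtr0_norm ?subr_gt0.
- apply: cmorse_morse; last first.
    apply: (morse_transfer XP l1 k0 (lexx 1) (lexx 0) (lexx 0) A0 n0 vq vm gq).
      by rewrite g0 a0 mdistxx.
    by rewrite gn aA mdistxx.
  by move=> Q q _ _; rewrite /= /M2 le_max lexx orbT.
- move=> _ [t + <-]; rewrite /= in_itv /= => /andP[t0 tn].
  have [||v /andP[v0 vA] Hv] := vm 1 0 0 A 0 n g (lexx _) (lexx _) (lexx _) A0 (lexx _) n0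
      gq _ _ t t0 tn.
  + by rewrite g0 a0.
  + by rewrite gn aA.
  exists (vtx (al v)) => //; exists (al v) => //; exact: aJ.
Qed.

End Coarsening.

Lemma cstable_le (R : realType) (G : groupType) (d : G -> G -> R) l k k' M M'
    (P : groupClosed G) : is_pseudometric d -> 0 <= k -> 0 <= l -> k <= k' ->
  (forall Q q, 1 <= Q -> 0 <= q -> M Q q <= M' Q q) ->
  cstable d l k M P -> cstable d l k' M' P.
Proof.
move=> dP k0 l0 kk MM sP x xP; have [A [al [A0 a0 aP aq am]]] := sP x xP.
exists A, al; split => //; last exact: cmorse_le am.
exact: (qgeo_le dP _ _ _ _ aq).
Qed.

(** The property is given for one generating set; the word metrics are bi-Lipschitz equivalent, and
    its coarse form passes between them. *)
Lemma MLTG_group_coarse (R : realType) (G : groupType) (S : finGenSet G) :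
  MLTG_group R G -> coarse_local_to_global (@word_dist R G S).
Proof.
move=> [S' hS'].
have [K [K0 HK]] := word_length_comparison S S'.
have [K' [K'0 HK']] := word_length_comparison S' S.
apply: (@local_to_global_comparable R G (word_dist S') (word_dist S) (maxn K K')%:R).
- by rewrite ler1n leq_max K0.
- move=> x y; rewrite /word_dist -natrM ler_nat; apply: leq_trans (HK' _) _.
  by rewrite leq_mul2r leq_maxr orbT.
- move=> x y; rewrite /word_dist -natrM ler_nat; apply: leq_trans (HK _) _.
  by rewrite leq_mul2r leq_maxl orbT.
- exact: MLTG_coarse.
Qed.

(** * The combination theorem under the Morse local-to-global property *)

Unset Implicit Arguments.

Theorem theoremA11 (R : realType) (G : groupType) (hG : MLTG_group R G)
    (S : finGenSet G) (MP MQ : morseGauge R) (rP rQ : R)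
    (hrP : 0 <= rP) (hrQ : 0 <= rQ) :
  exists C : R, 0 < C /\
    forall P Q : groupClosed G,
      stable_with S MP rP P -> stable_with S MQ rQ Q ->
      ((forall x : G, (x \in P) || (x \in Q) -> (word_length S x)%:R <= C ->
          x \in interG P Q) ->
        stable R S (joinG P Q) /\
        isomorphic (subgroup_type (joinG P Q)) (amalgam_inter P Q)) /\
      (almost_malnormal P ->
        (forall x : G, x \in P -> (word_length S x)%:R <= C ->
          x \in interG P Q) ->
        stable R S (joinG P Q) /\
        isomorphic (subgroup_type (joinG P Q)) (amalgam_inter P Q)).
Proof.
pose d := @word_dist R G S.
pose ball (r : R) := word_ball S (Num.truncn r).
have dP : is_pseudometric d by exact: word_dist_pseudometric.
have gd : coarsely_geodesic d by exact: word_dist_geodesic.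
have dM : forall g x y, d (g * x)%g (g * y)%g = d x y by exact: word_distM.
have ballP (r : R) x : d 1%g x <= r -> x \in ball r by exact: word_dist_ball.
pose gauge_of (M : morseGauge R) (r Q q : R) : R := let q' := q + 2 * r in
  Num.max 0 (M Q (q' + 2 * tame_const Q q') + tame_const Q q') + 2 * r.
(* Maxima give both subgroups a common gauge and a common additive constant. *)
pose M Q q := Num.max (gauge_of MP rP Q q) (gauge_of MQ rQ Q q).
pose k := 2 * Num.max rP rQ.
have k0 : 0 <= k by rewrite mulr_ge0 // le_max hrP.
have t0 : 0 <= triple_const ball k M.
  exact: le_trans k0 (le_trans (pair_const_ge ball M k0) (triple_const_ge ball M k0)).
have l9 : 1 <= 9 :> R by lra.
(* The local-to-global property is applied to the constants of [good]. *)
have [L [l' [k' [M' [L0 l'1 k'0 loc]]]]] :=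
  MLTG_group_coarse S hG (cat_gauge (cat_gauge M)) l9 t0.
have lk0 : 0 <= l' * k' by apply: mulr_ge0; lra.
(* [L] makes a long letter outlast a window, [l' * k'] prevents a path containing it from closing
   up, and [k] compares word length with parameter length. All are fixed before [P] and [Q]. *)
exists (L + l' * k' + k); split; first lra.
move=> P Q sP sQ.
have cP : cstable d 1 k M P.
  apply: cstable_le (stable_coarse hrP sP) => //; first lra.
    by rewrite /k ler_pM2l // le_max lexx.
  by move=> ? ? _ _; rewrite le_max lexx.
have cQ : cstable d 1 k M Q.
  apply: cstable_le (stable_coarse hrQ sQ) => //; first lra.
    by rewrite /k ler_pM2l // le_max lexx orbT.
  by move=> ? ? _ _; rewrite le_max lexx orbT.
have dwl x : d 1%g x = (word_length S x)%:R by exact: word_dist1.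
have main : (forall x, x \in P -> x \notin Q -> L + l' * k' + k < d 1%g x) ->
    almost_malnormal P \/
      (forall x, x \in Q -> x \notin P -> L + l' * k' + k < d 1%g x) ->
    stable R S (joinG P Q) /\
    isomorphic (subgroup_type (joinG P Q)) (amalgam_inter P Q).
  move=> long malQ; split.
    apply: (@coarse_stable R G S l' k' M') => //.
    exact: (join_cstable dP gd dM ballP dwl k0 cP cQ L0 l'1 k'0 loc long malQ).
  apply: amalgam_iso => w wn rw.
  exact: (reduced_neq1 dP gd dM ballP dwl k0 cP cQ L0 l'1 k'0 loc long malQ wn rw).
split=> [short|mal short]; apply: main.
- move=> x xP; apply: contraR; rewrite -leNgt dwl => /short.
  by rewrite xP inE /= => /(_ isT)/andP[].
- right=> x xQ; apply: contraR; rewrite -leNgt dwl => /short.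
  by rewrite xQ orbT inE /= => /(_ isT)/andP[].
- move=> x xP; apply: contraR; rewrite -leNgt dwl => /(short _ xP).
  by rewrite inE /= => /andP[].
- by left.
Qed.
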